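(* Let $\Omega_0\subset\mathbb R^n$ be a bounded convex domain with smooth boundary, let $\rho:[0,\infty)\to(0,\infty)$ be smooth with $\rho(0)=1$, $\lim_{t\to+\infty}\rho(t)=+\infty$ and $\lim_{t\to+\infty}\frac{\dot\rho(t)}{\rho(t)}=k\ge0$, and let $J:\mathbb R^n\to\mathbb R$ be continuous, nonnegative and compactly supported with $J(0)>0$, $\int_{\mathbb R^n}J(x)\,\mathrm dx=1$ and $\int_{\mathbb R^n}J(x)x\,\mathrm dx=0$. Then there exist a nonnegative function $\phi\in C^1(\mathbb R^n)$, which is strictly positive in $\Omega_0$ and vanishes outside $\Omega_0$, and a constant $T>0$ such that $$\int_{\Omega_0}J_{\frac1{\rho(t)}}(x-y)\phi(y)\,\mathrm dy-\phi(x)\ge-\frac1{\rho(t)}\phi(x)\qquad\text{for all }x\in\mathbb R^n,\ t\ge T.$$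
   Context: For $r>0$, $J_{\frac1r}(y):=r^nJ(ry)$; in particular $J_{\frac1{\rho(t)}}(y)=\rho^n(t)J(\rho(t)y)$. *)

(* Defs.v *)
From HB Require Import structures.
From mathcomp Require Import all_boot all_order all_algebra.
From mathcomp Require Import all_classical all_reals all_analysis.

Set Implicit Arguments.
Unset Strict Implicit.
Unset Printing Implicit Defensive.

Import Order.TTheory GRing.Theory Num.Theory.
Import numFieldNormedType.Exports.

Local Open Scope classical_set_scope.
Local Open Scope ring_scope.

(* The library has no Lebesgue measure on R^n. It is built here on n-tuples,
   which carry the product (= Borel) sigma-algebra, by recursion on n: the
   measure in dimension 0 is the Dirac mass, and the measure in dimension n + 1
   is the image of (1-dimensional Lebesgue) \x (n-dimensional Lebesgue) under
   (x, t) |-> x :: t. *)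
Section lebesgue_cons.
Context (R : realType) (n : nat).
Variable m : {sigma_finite_measure set (n.-tuple (measurableTypeR R)) -> \bar R}.

Definition pair_cons (p : measurableTypeR R * n.-tuple (measurableTypeR R)) :
  n.+1.-tuple (measurableTypeR R) := [tuple of p.1 :: p.2].

Lemma measurable_pair_cons : measurable_fun setT pair_cons.
Proof. exact: measurable_cons. Qed.

Definition lebesgue_cons : set (n.+1.-tuple (measurableTypeR R)) -> \bar R :=
  pushforward (@lebesgue_measure R \x m)%E pair_cons.

Let pre_measurable A : measurable A -> measurable (pair_cons @^-1` A).
Proof. by move=> mA; rewrite -[X in measurable X]setTI; exact: measurable_pair_cons. Qed.

Let lebesgue_cons0 : lebesgue_cons set0 = 0%E.
Proof. by rewrite /lebesgue_cons /pushforward preimage_set0 measure0. Qed.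

Let lebesgue_cons_ge0 A : (0 <= lebesgue_cons A)%E.
Proof. exact: (measure_ge0 (@lebesgue_measure R \x m)%E). Qed.

Let lebesgue_cons_sigma_additive : semi_sigma_additive lebesgue_cons.
Proof.
move=> F mF tF mUF; rewrite /lebesgue_cons /pushforward preimage_bigcup.
apply: measure_semi_sigma_additive.
- by move=> i; exact: pre_measurable.
- apply/trivIsetP => /= i j _ _ ij; rewrite -preimage_setI.
  by move/trivIsetP : tF => /(_ _ _ _ _ ij) ->//; rewrite preimage_set0.
- by rewrite -preimage_bigcup; exact: pre_measurable.
Qed.

HB.instance Definition _ := isMeasure.Build _ _ _ lebesgue_cons
  lebesgue_cons0 lebesgue_cons_ge0 lebesgue_cons_sigma_additive.

Let lebesgue_cons_sigma_finite : sigma_finite setT lebesgue_cons.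
Proof.
have /sigma_finiteP[F [TF ndF Foo]] := sigma_finiteT (@lebesgue_measure R).
have /sigma_finiteP[G [TG ndG Goo]] := sigma_finiteT m.
pose g (t : n.+1.-tuple (measurableTypeR R)) :
  measurableTypeR R * n.-tuple (measurableTypeR R) := (thead t, [tuple of behead t]).
have gK p : g (pair_cons p) = p.
  by case: p => x t; rewrite /g theadE; congr pair; exact: val_inj.
have mg : measurable_fun setT g.
  apply/measurable_fun_pairP; split.
    exact: measurable_tnth.
  exact: measurable_behead.
exists (fun k => g @^-1` (F k `*` G k)).
  rewrite -preimage_bigcup (_ : \bigcup_k _ = setT) ?preimage_setT//.
  rewrite -setXTT TF TG; apply/seteqP; split=> -[x t].
    by move=> [k _ []/= ? ?]; split; exists k.
  move=> [/= [i _ Fix] [j _ Gjt]]; exists (maxn i j) => //; split.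
  - by move: x Fix; exact/subsetPset/ndF/leq_maxl.
  - by move: t Gjt; exact/subsetPset/ndG/leq_maxr.
move=> k; have [mF Fk] := Foo k; have [mG Gk] := Goo k; split.
  by rewrite -[X in measurable X]setTI; apply: mg => //; exact: measurableX.
rewrite /lebesgue_cons /pushforward.
rewrite (_ : pair_cons @^-1` (g @^-1` (F k `*` G k)) = F k `*` G k).
  by rewrite product_measure1E// lte_mul_pinfty// ge0_fin_numE.
by rewrite -comp_preimage (_ : g \o pair_cons = id)//; exact/funext.
Qed.

HB.instance Definition _ := Measure_isSigmaFinite.Build _ _ _ lebesgue_cons
  lebesgue_cons_sigma_finite.

End lebesgue_cons.

Fixpoint lebesgue_tuple (R : realType) (n : nat) :
    {sigma_finite_measure set (n.-tuple (measurableTypeR R)) -> \bar R} :=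
  match n with
  | 0 => \d_([tuple] : 0.-tuple (measurableTypeR R))
  | n'.+1 => lebesgue_cons (lebesgue_tuple R n')
  end.

Lemma lebesgue_tuple_box (R : realType) (n : nat)
    (A : 'I_n -> set (measurableTypeR R)) : (forall i, measurable (A i)) ->
  lebesgue_tuple R n [set t | forall i, A i (tnth t i)] =
  (\prod_(i < n) lebesgue_measure (A i))%E.
Proof.
elim: n A => [|n IHn] A mA.
  rewrite big_ord0 /= /dirac indicE.
  by rewrite mem_set// => -[].
have mB : measurable [set t : n.-tuple (measurableTypeR R) |
    forall i, A (lift ord0 i) (tnth t i)].
  rewrite (_ : mkset _ = \bigcap_(i in [set: 'I_n])
     ((fun t => tnth t i) @^-1` A (lift ord0 i))).
    apply: fin_bigcap_measurable => // i _.
    by rewrite -[X in measurable X]setTI; exact: measurable_tnth.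
  by apply/seteqP; split=> t /= h i; [move=> _|]; exact: h.
rewrite big_ord_recl -IHn// -product_measure1E//.
rewrite /= /lebesgue_cons /pushforward; congr product_measure1.
apply/seteqP; split=> -[x t] /= h.
  split; first exact: (h ord0).
  by move=> i; have := h (lift ord0 i); rewrite tnthS.
by move=> i; case: (unliftP ord0 i) => [j ->|->]; [rewrite tnthS; apply h.2|exact: h.1].
Qed.

Definition row_of_tuple (R : realType) (n : nat)
  (t : n.-tuple (measurableTypeR R)) : 'rV[R]_n := \row_i tnth t i.

Definition integral_Rn (R : realType) (n : nat) (D : set 'rV[R]_n)
    (f : 'rV[R]_n -> R) : R :=
  \int[lebesgue_tuple R n]_(t in @row_of_tuple R n @^-1` D) f (row_of_tuple t).

Definition dpartial (R : realType) (n : nat) (i : 'I_n) (f : 'rV[R]_n -> R) :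
  'rV[R]_n -> R := fun x => 'D_(delta_mx 0 i) f x.

Definition iter_dpartial (R : realType) (n : nat) (s : seq 'I_n)
  (f : 'rV[R]_n -> R) : 'rV[R]_n -> R := foldr (@dpartial R n) f s.

(* All partial derivatives of order at most k exist and are continuous at every
   point of U; to be used with U open. Existence is a separate clause because
   'D_v is a total operator. *)
Definition Ck_on (R : realType) (n k : nat) (U : set 'rV[R]_n)
    (f : 'rV[R]_n -> R) : Prop :=
  forall s : seq 'I_n, (size s <= k)%N -> forall x, U x ->
    {for x, continuous (iter_dpartial s f)} /\
    ((size s < k)%N ->
      forall i, derivable (iter_dpartial s f) x (delta_mx 0 i)).

Definition smooth_on (R : realType) (n : nat) (U : set 'rV[R]_n)
  (f : 'rV[R]_n -> R) : Prop := forall k, Ck_on k U f.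

(* D k is the k-th derivative of f on [0, +oo[, one-sided at 0. *)
Definition smooth_on_half_line (R : realType) (f : R -> R) : Prop :=
  exists D : nat -> R -> R,
    (forall t, 0 <= t -> D 0 t = f t) /\
    (forall k t, 0 <= t ->
      (D k s - D k t) / (s - t) @[s --> within `[0, +oo[ t^'] --> D k.+1 t).

Definition boundary (T : topologicalType) (A : set T) : set T :=
  closure A `\` interior A.

Definition domain (T : topologicalType) (A : set T) : Prop :=
  [/\ A !=set0, open A & connected A].

(* Near each boundary point A is the sublevel set of a smooth function with
   nonvanishing gradient, so A lies locally on one side of the smooth
   hypersurface boundary A. *)
Definition smooth_boundary (R : realType) (n : nat) (A : set 'rV[R]_n) : Prop :=
  forall p, boundary A p ->
  exists (U : set 'rV[R]_n) (g : 'rV[R]_n -> R),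
    [/\ open U /\ U p,
        smooth_on U g,
        forall x, U x -> exists i, dpartial i g x != 0,
        forall x, U x -> (A x <-> g x < 0) &
        forall x, U x -> (boundary A x <-> g x = 0)].

Definition compactly_supported (T : topologicalType) (R : realType)
  (f : T -> R) : Prop := compact (closure [set x | f x != 0]).

(* rescale J r is written J_{1/r} in the source. *)
Definition rescale (R : realType) (n : nat) (J : 'rV[R]_n -> R) (r : R) :
  'rV[R]_n -> R := fun y => r ^+ n * J (r *: y).

(* Main.v *)
From HB Require Import structures.
Require Import Defs.
From mathcomp Require Import all_boot all_order all_algebra.
From mathcomp Require Import all_classical all_reals all_analysis.
From mathcomp Require Import measurable_realfun ring lra.

(** Put [e = 1 / rho t]. The claim says that averaging [phi (x - e z)] against the
   density [J z] loses at most the factor [1 - e], once [e] is small. This property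
   is preserved by superposition with nonnegative weights as long as the threshold
   on [e] is common to all the terms, so it suffices to establish it for the
   translates of one profile and to cover Omega0 by inner balls of one radius.

   The profile is [bump s a x], the square of the positive part of
   [q = s - |x - a|^2]. If [q > 0] and [l = x - a], the value of [q] at [x - e z] is
   [q + 2 e l.z - e^2 |z|^2]. Without the last term, averaging the square of the
   positive part would give at least [q^2 + 4 e^2 c |l|^2] for some [c > 0]: the
   linear term disappears because [J] is centred, and the square of the positive
   part of [l.z] is a gain of order [|l|^2] because [J] is positive near 0
   ([average_pospart_dotp_ge]). Restoring the last term costs, by Young's inequality
   with parameter [e / 2], half of the allowed loss [e q^2], a small fraction of the
   gain, and an error of order [e^3] ([pospart_sqr_perturb]). Since [q + |l|^2 = s], the quantities [q] and [l]
   are never small together: either the other half of [e q^2] or the gain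
   in [e^2 |l|^2] absorbs [e^3] for small [e], uniformly in [x] and [a]
   ([average_bump_ge]).

   The smooth boundary yields a radius such that every point of Omega0 lies in an
   open Euclidean ball of that radius contained in Omega0
   ([interior_ball_condition]). Countably many such balls cover Omega0, and [phi] is
   the sum of their bumps with weights [2^-(j+1)]. It is positive exactly on Omega0.
   It is C^1 because the bumps satisfy first-order Taylor and Lipschitz estimates
   whose constants at a point [x] are common to all the centres, which stay in a
   bounded set ([dmean_derive], [dmean_continuous]);
   the inequality passes to [phi] from its partial sums, which bound it from below.
   The rescaled convolution is turned into an average against [J] by the change of
   variable [y = x - e z] for Lebesgue measure on tuples. *)

Import Order.TTheory GRing.Theory Num.Theory.
Import numFieldNormedType.Exports.

Local Open Scope classical_set_scope.
Local Open Scope ring_scope.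
Set Implicit Arguments.
Unset Strict Implicit.
Unset Printing Implicit Defensive.

(** * Reflection and scaling in Lebesgue measure *)
Section ChangeOfVariable.
Context (R : realType).

(** The measure structure of an image depends on a proof that [f] is measurable, which
   unification cannot supply, so it is named explicitly. *)
Let scaled_image d1 d2 (T1 : measurableType d1) (T2 : measurableType d2)
    (r : R) (r0 : 0 <= r) (m : {measure set T1 -> \bar R}) (f : T1 -> T2)
    (mf : measurable_fun setT f) : {measure set T2 -> \bar R} :=
  mscale (NngNum r0) (measure_function_pushforward__canonical__measure_function_Measure m mf).

Let reflect_scale (c e : R) (z : measurableTypeR R) : measurableTypeR R := c - e * z.

Let measurable_reflect_scale c e : measurable_fun setT (reflect_scale c e).
Proof. by apply: measurable_funD => //; apply: measurableT_comp => //; exact: measurable_funM. Qed.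

(** The left side is a measure in [A], and it has the right value on half-open intervals. *)
Lemma lebesgue_measure_reflect_scale (c e : R) (A : set (measurableTypeR R)) :
  0 < e -> measurable A ->
  (e%:E * lebesgue_measure (reflect_scale c e @^-1` A))%E = lebesgue_measure A.
Proof.
move=> e0 mA.
pose nu := scaled_image (ltW e0) (@lebesgue_measure R) (measurable_reflect_scale c e).
rewrite -[LHS]/(nu A); apply/esym/lebesgue_measure_unique => //= _ [[a b]] _ <-.
rewrite /nu /scaled_image /= /mscale /= /pushforward.
have -> : reflect_scale c e @^-1` `]a, b] = `[(c - b) / e, (c - a) / e[%classic.
  apply/seteqP; split=> z; rewrite /= !in_itv/= /reflect_scale.
    by rewrite ler_pdivrMr// ltr_pdivlMr// => /andP[? ?]; apply/andP; split; lra.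
  by rewrite ler_pdivrMr// ltr_pdivlMr// => /andP[? ?]; apply/andP; split; lra.
rewrite !lebesgue_measure_itv/= !lte_fin ltr_pM2r ?invr_gt0// ltrD2l ltrN2.
case: ifP => _; last by rewrite mule0.
rewrite -EFinD -EFinM; congr EFin; field; exact: lt0r_neq0.
Qed.

Let reflect_scale_tuple n (c : 'I_n -> R) (e : R) (t : n.-tuple (measurableTypeR R)) :
  n.-tuple (measurableTypeR R) := [tuple reflect_scale (c i) e (tnth t i) | i < n].

Let measurable_reflect_scale_tuple n (c : 'I_n -> R) e :
  measurable_fun setT (reflect_scale_tuple c e).
Proof.
apply/measurable_fun_tnthP => i.
rewrite (_ : _ \o _ = reflect_scale (c i) e \o (fun t => tnth t i)); last first.
  by apply/funext => t /=; rewrite tnth_mktuple.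
by apply: measurableT_comp => //; exact: measurable_tnth.
Qed.

(** By induction on the dimension: both sides are measures on the product that agree
   on rectangles, and the product measure is characterised by its rectangles. *)
Lemma lebesgue_tuple_reflect_scale n (c : 'I_n -> R) (e : R) A :
  0 < e -> measurable A ->
  ((e ^+ n)%:E * lebesgue_tuple R n (reflect_scale_tuple c e @^-1` A))%E =
  lebesgue_tuple R n A.
Proof.
move=> e0; elim: n c A => [|n IHn] c A mA.
  rewrite expr0 mul1e; congr (lebesgue_tuple R 0 _).
  by apply/seteqP; split=> t; rewrite /= [reflect_scale_tuple _ _ _]tuple0 [t]tuple0.
pose T1 : _ -> measurableTypeR R := reflect_scale (c ord0) e.
pose T2 := reflect_scale_tuple (fun i => c (lift ord0 i)) e.
pose T (p : measurableTypeR R * n.-tuple (measurableTypeR R)) := (T1 p.1, T2 p.2).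
have mT : measurable_fun setT T.
  apply/measurable_fun_pairP; split.
    exact: (measurableT_comp (measurable_reflect_scale _ _) measurable_fst).
  exact: (measurableT_comp (measurable_reflect_scale_tuple _ _) measurable_snd).
have e'0 : 0 <= e ^+ n.+1 by rewrite exprn_ge0// ltW.
pose nu := scaled_image e'0 (@lebesgue_measure R \x lebesgue_tuple R n)%E mT.
have mB : measurable (@pair_cons R n @^-1` A).
  by rewrite -[X in measurable X]setTI; exact: measurable_pair_cons.
transitivity (nu (@pair_cons R n @^-1` A)).
  rewrite /nu /mscale /= /pushforward /=; congr (_ * _)%E.
  rewrite /lebesgue_cons /pushforward; congr product_measure1.
  apply/seteqP; split=> -[x t] /=; rewrite (_ : reflect_scale_tuple _ _ _ = pair_cons (T (x, t)))//.
    apply: eq_from_tnth => i; rewrite tnth_mktuple.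
    by case: (unliftP ord0 i) => [j ->|->]; rewrite /pair_cons/= ?tnthS ?tnth_mktuple// !tnth0.
  apply: eq_from_tnth => i; rewrite tnth_mktuple.
  by case: (unliftP ord0 i) => [j ->|->]; rewrite /pair_cons/= ?tnthS ?tnth_mktuple// !tnth0.
rewrite -[RHS]/((@lebesgue_measure R \x lebesgue_tuple R n)%E (@pair_cons R n @^-1` A)).
apply/esym/product_measure_unique => // B1 B2 mB1 mB2.
rewrite /nu /scaled_image /= /mscale /= /pushforward.
rewrite (_ : T @^-1` _ = (T1 @^-1` B1) `*` (T2 @^-1` B2))//.
rewrite product_measure1E//; last 2 first.
- by rewrite -[X in measurable X]setTI; exact: measurable_reflect_scale.
- by rewrite -[X in measurable X]setTI; exact: measurable_reflect_scale_tuple.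
rewrite -(lebesgue_measure_reflect_scale (c ord0) e0 mB1).
rewrite -(IHn (fun i => c (lift ord0 i)) _ mB2).
by rewrite exprS EFinM !muleA; congr (_ * _)%E; rewrite -!muleA; congr (_ * _)%E; rewrite muleC.
Qed.

Lemma integral_Rn_reflect_scale n (x : 'rV[R]_n) (e : R) (h : 'rV[R]_n -> R) :
  0 < e -> measurable_fun setT (h \o @row_of_tuple R n) -> (forall y, 0 <= h y) ->
  e ^+ n * integral_Rn setT (fun z => h (x - e *: z)) = integral_Rn setT h.
Proof.
move=> e0 mh h0; rewrite /integral_Rn preimage_setT /Rintegral.
pose T := reflect_scale_tuple (fun i => x 0 i) e.
have TE t : x - e *: row_of_tuple t = row_of_tuple (T t).
  by apply/rowP => i; rewrite !mxE tnth_mktuple.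
under eq_integral do rewrite TE.
have e'0 : 0 <= e ^+ n by rewrite exprn_ge0// ltW.
rewrite [X in _ * fine X = _](_ : _ =
    \int[lebesgue_tuple R n]_(t in T @^-1` setT)
       ((EFin \o h \o @row_of_tuple R n) \o T) t)%E; last by rewrite preimage_setT.
have mT : measurable_fun setT T by exact: measurable_reflect_scale_tuple.
rewrite -(ge0_integral_pushforward mT)//; last 2 first.
- exact/measurable_EFinP.
- by move=> t _; rewrite lee_fin.
pose nu := scaled_image e'0 (lebesgue_tuple R n) mT.
rewrite -[X in X * _]/(fine (e ^+ n)%:E).
transitivity (fine (\int[nu]_t (h (row_of_tuple t))%:E)).
  rewrite /nu ge0_integral_mscale//; last 2 first.
  - exact/measurable_EFinP.
  - by move=> t _; rewrite lee_fin.
  have en0 : 0 < e ^+ n by rewrite exprn_gt0.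
  set I := (X in fine _ * fine X = _); rewrite -[X in _ = fine (_ * X)]/I.
  case: I => [v| |] //=.
    by rewrite gt0_muley ?lte_fin//= mulr0.
  by rewrite gt0_muleNy ?lte_fin//= mulr0.
congr fine; apply: eq_measure_integral => A mA _.
by apply: lebesgue_tuple_reflect_scale.
Qed.

End ChangeOfVariable.

(** * Measurability of continuous functions of a row *)
Lemma row_ball_tnth (R : realType) n (c : 'rV[R]_n) (r : R) :
  0 < r -> @row_of_tuple R n @^-1` ball c r =
  \bigcap_(i in [set: 'I_n]) ((fun t => tnth t i) @^-1` ball (c 0 i) r).
Proof.
move=> r0; apply/seteqP; split=> t /=.
  by move=> [_ h] i _; have := h 0 i; rewrite mxE.
by move=> h; split=> // i j; rewrite mxE ord1; exact: h.
Qed.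

Lemma rat_row_dense (R : realType) n (x : 'rV[R]_n) (r : R) : 0 < r ->
  exists p : 'rV[rat]_n, ball (map_mx ratr p : 'rV[R]_n) r x.
Proof.
move=> r0.
have ap i : exists a : rat, x 0 i - r < ratr a < x 0 i + r.
  have : x 0 i - r < x 0 i + r by lra.
  by move/rat_in_itvoo => [a]; rewrite in_itv/=; exists a.
exists (\row_i projT1 (cid (ap i))); split=> // i j; rewrite !mxE ord1.
case: cid => a /= /andP[? ?].
by rewrite /ball/= ltr_distlC; apply/andP; split; lra.
Qed.

(** The sigma-algebra on tuples is generated by the coordinates. Balls for the
   supremum norm are boxes, so an open set is a countable union of measurable boxes
   with rational centres and radii. *)
Lemma measurable_open_row (R : realType) n (O : set 'rV[R]_n) :
  open O -> measurable (@row_of_tuple R n @^-1` O).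
Proof.
move=> oO.
pose c (p : 'rV[rat]_n) : 'rV[R]_n := map_mx ratr p.
pose B (p : 'rV[rat]_n * rat) : set 'rV[R]_n :=
  if `[< 0 < p.2 /\ ball (c p.1) (ratr p.2) `<=` O >]
  then ball (c p.1) (ratr p.2) else set0.
have -> : O = \bigcup_p B p.
  apply/seteqP; split=> x; last first.
    by move=> [p _]; rewrite /B; case: asboolP => // -[_ +]; exact.
  move=> Ox; have /nbhs_ballP[e /= e0 eO] : nbhs x O by exact: open_nbhs_nbhs.
  have [q q0 qe] : exists2 q : rat, 0 < q & ratr q < e / 2.
    have e20 : 0 < e / 2 by rewrite divr_gt0.
    have [q] := rat_in_itvoo e20; rewrite in_itv/= => /andP[q0 qe].
    by exists q => //; rewrite -(ltr0q R).
  have q0R : 0 < ratr q :> R by rewrite ltr0q.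
  have [p xp] := rat_row_dense x q0R.
  exists (p, q) => //; rewrite /B /= asboolT//; split=> // y py.
  apply: eO; apply: (@ball_split _ _ (c p)).
    by apply: (@le_ball _ _ _ (ratr q)); [exact: ltW|exact: ball_sym].
  by apply: (@le_ball _ _ _ (ratr q)) py; exact: ltW.
rewrite preimage_bigcup; apply: countable_bigcupT_measurable => //.
move=> p; rewrite /B; case: asboolP => [[p0 _]|_]; last by rewrite preimage_set0.
rewrite row_ball_tnth ?ltr0q//.
apply: fin_bigcap_measurable => // i _.
rewrite -[X in measurable X]setTI; apply: measurable_tnth => //.
exact: measurable_ball.
Qed.

Lemma measurable_continuous_row (R : realType) n (f : 'rV[R]_n -> R) :
  continuous f -> measurable_fun setT (f \o @row_of_tuple R n).
Proof.
move=> cf; apply: (measurability (@RGenOpens.G R)); first exact: RGenOpens.measurableE.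
move=> _ [_ [a [b ->] <-]]; rewrite setTI comp_preimage.
apply: measurable_open_row; apply: open_comp => // x _; exact: cf.
Qed.

(** * Euclidean square norm on rows *)
Section EuclideanRow.
Context (R : realType) (n : nat).
Implicit Types (x y z u v : 'rV[R]_n).

Definition sqnorm x : R := \sum_i x 0 i ^+ 2.
Definition dotp x y : R := \sum_i x 0 i * y 0 i.

Lemma sqnorm_ge0 x : 0 <= sqnorm x.
Proof. by apply: sumr_ge0 => i _; exact: sqr_ge0. Qed.

Lemma coord_le_norm x i : `|x 0 i| <= `|x|.
Proof.
rewrite [leRHS]/Num.norm/= mx_normrE.
exact: (le_bigmax _ (fun ij : 'I_1 * 'I_n => `|x ij.1 ij.2|) (0, i)).
Qed.

Lemma norm_sqr_le_sqnorm x : `|x| ^+ 2 <= sqnorm x.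
Proof.
have [->|x0] := eqVneq `|x| 0; first by rewrite expr0n/= sqnorm_ge0.
have [[j i] /= xE] := mx_norm_neq0 x0.
rewrite [X in X ^+ 2]xE (ord1 j) real_normK ?num_real// /sqnorm (bigD1 i)//= lerDl.
by apply: sumr_ge0 => k _; exact: sqr_ge0.
Qed.

Lemma sqnormD x y : sqnorm (x + y) = sqnorm x + 2 * dotp x y + sqnorm y.
Proof.
rewrite /sqnorm /dotp mulr_sumr -!big_split/=; apply: eq_bigr => i _.
by rewrite mxE; ring.
Qed.

Lemma sqnormZ a x : sqnorm (a *: x) = a ^+ 2 * sqnorm x.
Proof. by rewrite /sqnorm mulr_sumr; apply: eq_bigr => i _; rewrite mxE exprMn. Qed.

Lemma sqnormN x : sqnorm (- x) = sqnorm x.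
Proof. by apply: eq_bigr => i _; rewrite mxE sqrrN. Qed.

Lemma dotpZr a x y : dotp x (a *: y) = a * dotp x y.
Proof. by rewrite /dotp mulr_sumr; apply: eq_bigr => i _; rewrite mxE; ring. Qed.

Lemma dotpZl a x y : dotp (a *: x) y = a * dotp x y.
Proof. by rewrite /dotp mulr_sumr; apply: eq_bigr => i _; rewrite mxE; ring. Qed.

Lemma sqnormB x y : sqnorm (x - y) = sqnorm x - 2 * dotp x y + sqnorm y.
Proof. by rewrite sqnormD sqnormN -scaleN1r dotpZr; ring. Qed.

Lemma sqnorm_convex (t : R) u v : 0 <= t <= 1 ->
  sqnorm (t *: u + (1 - t) *: v) <= t * sqnorm u + (1 - t) * sqnorm v.
Proof.
move=> /andP[t0 t1].
have := sqnorm_ge0 (u - v); rewrite sqnormB sqnormD !sqnormZ dotpZl dotpZr => h.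
rewrite -subr_ge0 (_ : _ - _ = t * (1 - t) * (sqnorm u - 2 * dotp u v + sqnorm v)).
  by rewrite !mulr_ge0// subr_ge0.
ring.
Qed.

Lemma sqnorm_continuous : continuous sqnorm.
Proof.
apply: continuous_big => [|i _ x]; first exact: add_continuous.
have ci : {for x, continuous (fun y : 'rV[R]_n => y 0 i)} by exact: coord_continuous.
exact: (continuousM ci ci).
Qed.

End EuclideanRow.

(** * A mean value theorem from partial derivatives *)
Section Staircase.
Context (R : realType) (n : nat).
Implicit Types (f : 'rV[R]_n -> R) (x y p : 'rV[R]_n).

Lemma is_derive_line f x i (t : R) :
  derivable f (x + t *: delta_mx 0 i) (delta_mx 0 i) ->
  is_derive t 1 (fun s => f (x + s *: delta_mx 0 i))
    (dpartial i f (x + t *: delta_mx 0 i)).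
Proof.
move=> df.
have E : (fun h : R => h^-1 *: ((fun s => f (x + s *: delta_mx 0 i)) (h *: 1 + t)
     - (fun s => f (x + s *: delta_mx 0 i)) t)) =
  (fun h : R => h^-1 *: (f (h *: delta_mx 0 i + (x + t *: delta_mx 0 i))
     - f (x + t *: delta_mx 0 i))).
  apply/funext => h; congr (_ *: (f _ - _)).
  by rewrite scalerDl addrCA /= [h *: 1]mulr1.
split; first by rewrite /derivable; move: df; rewrite /derivable /= -E.
by rewrite /dpartial /derive /= E.
Qed.

Lemma coord_mvt f x i (s : R) :
  (forall t : R, 0 <= t <= 1 ->
    derivable f (x + (t * s) *: delta_mx 0 i) (delta_mx 0 i)) ->
  exists2 t : R, 0 <= t <= 1 &
    f (x + s *: delta_mx 0 i) - f x = dpartial i f (x + (t * s) *: delta_mx 0 i) * s.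
Proof.
move=> df; pose h t := f (x + (t * s) *: delta_mx 0 i).
have dh (t : R) : 0 <= t <= 1 ->
    is_derive t 1 h (dpartial i f (x + (t * s) *: delta_mx 0 i) * s).
  move=> t01; rewrite (_ : h = (fun u => f (x + u *: delta_mx 0 i)) \o (s \*: id)); last first.
    by apply/funext => u; rewrite /h /= [s *: u]mulrC.
  apply: (@is_derive1_comp _ (fun u => f (x + u *: delta_mx 0 i)) (s \*: id)).
    rewrite /= [s *: t]mulrC; apply: is_derive_line; exact: df.
  rewrite [X in is_derive _ _ _ X](_ : s = s *: 1); last by rewrite [RHS]mulr1.
  exact: is_deriveZ.
have ch : {within `[0, 1], continuous h}.
  apply: derivable_within_continuous => t; rewrite in_itv/= => /dh.
  by case.
have [t t01 E] : exists2 c : R, c \in `[0, 1]%R &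
    h 1 - h 0 = dpartial i f (x + (c * s) *: delta_mx 0 i) * s * (1 - 0).
  apply: (@MVT_segment _ h (fun c => dpartial i f (x + (c * s) *: delta_mx 0 i) * s)) => //.
  by move=> t; rewrite in_itv/= => /andP[/ltW ? /ltW ?]; apply: dh; apply/andP.
exists t; first by move: t01; rewrite in_itv.
by move: E; rewrite /h mul1r mul0r scale0r addr0 subr0 mulr1.
Qed.

(** Only partial derivatives are available, so [x] is joined to [y] by changing one
   coordinate at a time. The intermediate points stay in the box spanned by [x] and
   [y], hence in every supremum-norm ball that contains both. *)
Lemma staircase_mvt f p (e : R) x y :
  (forall z i, ball p e z -> derivable f z (delta_mx 0 i)) ->
  ball p e x -> ball p e y ->
  exists2 xi : 'I_n -> 'rV[R]_n,
    forall i, ball p e (xi i) /\ `|xi i - x| <= `|y - x| &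
    f y - f x = \sum_i dpartial i f (xi i) * (y - x) 0 i.
Proof.
move=> df px py.
pose w (k : nat) : 'rV[R]_n := \row_j (if (j < k)%N then y 0 j else x 0 j).
have wS (i : 'I_n) : w i.+1 = w i + (y - x) 0 i *: delta_mx 0 i.
  apply/rowP => j; rewrite !mxE eqxx/= ltnS leq_eqVlt.
  have [->|ji] := eqVneq j i; first by rewrite eqxx ltnn/= mulr1 subrKC.
  by rewrite (negbTE (_ : (j : nat) != i))// mulr0 addr0.
have wt (i : 'I_n) (t : R) : 0 <= t <= 1 ->
    forall j, (w i + (t * (y - x) 0 i) *: delta_mx 0 i) 0 j = x 0 j \/
    exists2 s : R, 0 <= s <= 1 &
      (w i + (t * (y - x) 0 i) *: delta_mx 0 i) 0 j = x 0 j + s * (y 0 j - x 0 j).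
  move=> t01 j; rewrite !mxE eqxx/=.
  have [->|ji] := eqVneq j i; first by right; exists t => //; rewrite ltnn mulr1.
  rewrite mulr0 addr0; case: ifP => _; [right|by left].
  by exists 1; rewrite ?ler01 ?lexx//; ring.
have inball (i : 'I_n) (t : R) : 0 <= t <= 1 ->
    ball p e (w i + (t * (y - x) 0 i) *: delta_mx 0 i).
  move=> t01; move: px py => [e0 px] [_ py]; split=> // k j; rewrite (ord1 k).
  move: (px 0 j) (py 0 j); rewrite /ball/= !ltr_distl => /andP[? ?] /andP[? ?].
  have [->|[s /andP[s0 s1] ->]] := wt i t t01 j; first by apply/andP.
  have conv (A B : R) : 0 < A -> 0 < B -> 0 < A + s * (B - A).
    by move=> A0 B0; case: (leP A B) => AB; nra.
  have c1 : 0 < x 0 j - (p 0 j - e) by lra.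
  have c2 : 0 < y 0 j - (p 0 j - e) by lra.
  have c3 : 0 < p 0 j + e - x 0 j by lra.
  have c4 : 0 < p 0 j + e - y 0 j by lra.
  by have := conv _ _ c1 c2; have := conv _ _ c3 c4; move=> *; apply/andP; split; lra.
have nearx (i : 'I_n) (t : R) : 0 <= t <= 1 ->
    `|w i + (t * (y - x) 0 i) *: delta_mx 0 i - x| <= `|y - x|.
  move=> t01; have := wt i t t01.
  move: (w i + _) => a wa; rewrite [leLHS]/Num.norm/= mx_normrE.
  apply/bigmax_leP; split=> // -[k j] _ /=; rewrite (ord1 k).
  have := coord_le_norm (y - x) j; rewrite !mxE => h.
  have [->|[s /andP[s0 s1] ->]] := wa j; first by rewrite subrr normr0.
  rewrite addrC addKr normrM (ger0_norm s0).
  by apply: le_trans h; rewrite ler_piMl.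
(* The i-th leg of the staircase goes from w i to w i.+1. *)
have step (i : 'I_n) : exists xi, (ball p e xi /\ `|xi - x| <= `|y - x|) /\
    f (w i.+1) - f (w i) = dpartial i f xi * (y - x) 0 i.
  have [t t01 E] : exists2 t : R, 0 <= t <= 1 & f (w i + (y - x) 0 i *: delta_mx 0 i) - f (w i) =
     dpartial i f (w i + (t * (y - x) 0 i) *: delta_mx 0 i) * (y - x) 0 i.
    by apply: coord_mvt => t t01; apply: df; exact: inball.
  exists (w i + (t * (y - x) 0 i) *: delta_mx 0 i).
  by rewrite wS; split; [split; [exact: inball|exact: nearx]|].
exists (fun i => projT1 (cid (step i))) => [i|]; first by case: cid => ? /= [].
have -> : f y - f x = \sum_(0 <= k < n) (f (w k.+1) - f (w k)).
  rewrite telescope_sumr//; congr (f _ - f _); apply/rowP => j; rewrite mxE ?ltn_ord//.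
by rewrite big_mkord; apply: eq_bigr => i _; case: cid => ? /= [].
Qed.

End Staircase.

(** * The interior ball condition *)
Section InteriorBall.
Context (R : realType) (n : nat).
Implicit Types (Om : set 'rV[R]_n) (x y a p : 'rV[R]_n).

(** The index [s] is the squared radius, so that membership is a polynomial inequality. *)
Definition eball a (s : R) : set 'rV[R]_n := [set y | sqnorm (y - a) < s].

Definition in_inner_ball Om (s : R) x := exists2 a, eball a s x & eball a s `<=` Om.

(** The smaller ball is the image of the larger one under a homothety centred at [x].
   It stays inside by convexity of the square norm. *)
Lemma in_inner_ball_shrink Om (s s' : R) x :
  0 < s' <= s -> in_inner_ball Om s x -> in_inner_ball Om s' x.
Proof.
move=> /andP[s'0 s's] [a xa aOm].
have s0 : 0 < s by exact: lt_le_trans s's.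
pose t := Num.sqrt (s' / s).
have t2 : t ^+ 2 = s' / s by rewrite sqr_sqrtr// divr_ge0// ltW.
have t0 : 0 < t by rewrite sqrtr_gt0 divr_gt0.
have t1 : t <= 1 by rewrite -sqrtr1 ler_wsqrtr// ler_pdivrMr// mul1r.
exists (x + t *: (a - x)).
  rewrite /eball/= opprD addNKr -scalerN opprB sqnormZ t2.
  rewrite mulrAC ltr_pdivrMr// ltr_pM2l//.
move=> y; rewrite /eball/= => ya; apply: aOm; rewrite /eball/=.
pose u := t^-1 *: (y - (x + t *: (a - x))).
have -> : y - a = t *: u + (1 - t) *: (x - a).
  rewrite /u scalerA divff ?gt_eqF// scale1r scalerBl scale1r.
  apply/rowP => i; rewrite !mxE; ring.
have us : sqnorm u < s.
  by rewrite sqnormZ exprVn t2 invf_div mulrAC ltr_pdivrMr// ltr_pM2l.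
apply: le_lt_trans (sqnorm_convex _ _ _) _; first by rewrite t1 ltW.
have : (1 - t) * sqnorm (x - a) <= (1 - t) * s.
  by rewrite ler_wpM2l ?subr_ge0// ltW.
have : t * sqnorm u < t * s by rewrite ltr_pM2l.
lra.
Qed.

Definition grad (g : 'rV[R]_n -> R) x : 'rV[R]_n := \row_i dpartial i g x.

Lemma near_abs_le (T : topologicalType) (f : T -> R) (p : T) :
  {for p, continuous f} -> \forall z \near p, `|f z| <= `|f p| + 1.
Proof.
move=> cf; have := cvgr_norm_le _ cf; apply.
by rewrite ltrDl.
Qed.

(** The mean value theorem is used twice, for [g] and for its first partial
   derivatives, whose own partial derivatives are bounded near [p]. *)
Lemma second_order_upper_bound (U : set 'rV[R]_n) (g : 'rV[R]_n -> R) p :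
  open U -> U p -> Ck_on 2 U g ->
  exists2 e : R, 0 < e & exists2 L : R, 0 <= L &
    ball p e `<=` U /\ forall x y, ball p e x -> ball p e y ->
      g y <= g x + dotp (grad g x) (y - x) + L * sqnorm (y - x).
Proof.
move=> oU Up C2.
pose d2 (ij : 'I_n * 'I_n) := dpartial ij.1 (dpartial ij.2 g).
pose M := \sum_ij (`|d2 ij p| + 1).
have M0 : 0 <= M by apply: sumr_ge0 => ij _; rewrite addr_ge0.
have nearM : \forall z \near p, forall ij, `|d2 ij z| <= M.
  apply: (@filter_forall _ _ (fun ij z => is_true (`|d2 ij z| <= M)) (nbhs p)) => ij.
  have /near_abs_le : {for p, continuous (d2 ij)}.
    by have [] := C2 [:: ij.1; ij.2] isT p Up.
  apply: filterS => z /le_trans; apply; rewrite /M (bigD1 ij)//= lerDl.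
  by apply: sumr_ge0 => k _; rewrite addr_ge0.
have nearU : nbhs p U by exact: open_nbhs_nbhs.
have : nbhs p (U `&` [set z | forall ij, `|d2 ij z| <= M]) by exact: filterI.
move=> /nbhs_ballP[e /= e0 eP].
exists e => //; exists (\sum_(i < n) \sum_(j < n) M).
  by apply: sumr_ge0 => i _; apply: sumr_ge0.
split=> [z /eP[]//|x y px py].
have dg z i : ball p e z -> derivable g z (delta_mx 0 i).
  by move=> /eP[Uz _]; have [_ +] := C2 [::] isT z Uz; exact.
have ddg j z i : ball p e z -> derivable (dpartial j g) z (delta_mx 0 i).
  by move=> /eP[Uz _]; have [_ +] := C2 [:: j] isT z Uz; exact.
have [xi xiP E] := staircase_mvt (fun z i => dg z i) px py.
rewrite -lerBlDl opprD addrA.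
have -> : g y - g x - dotp (grad g x) (y - x) =
    \sum_i (dpartial i g (xi i) - dpartial i g x) * (y - x) 0 i.
  rewrite E /dotp -sumrB; apply: eq_bigr => i _.
  by rewrite [grad _ _ _ _]mxE mulrBl.
rewrite mulr_suml; apply: ler_sum => i _.
apply: le_trans (ler_norm _) _; rewrite normrM.
have [pxi xix] := xiP i.
have [eta etaP ->] := staircase_mvt (fun z j => ddg i z j) px pxi.
apply: (@le_trans _ _ ((\sum_(j < n) M * `|y - x|) * `|y - x|)).
  apply: ler_pM => //; last exact: coord_le_norm.
  apply: le_trans (ler_norm_sum _ _ _) _; apply: ler_sum => j _.
  rewrite normrM; apply: ler_pM => //.
    by have [/eP[_ /(_ (j, i))]] := etaP j.
  by apply: le_trans xix; exact: coord_le_norm.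
rewrite -mulr_suml -mulrA -expr2 ler_wpM2l ?norm_sqr_le_sqnorm//.
by apply: sumr_ge0.
Qed.

(** Let [v] be the gradient of [g] at a point [x] of the sublevel set. On the ball
   centred at [x - tau v] with squared radius [tau^2 |v|^2 + d], which contains [x],
   one has [v.(y - x) < (d - |y - x|^2) / (2 tau)]. If [2 tau L <= 1], the second
   order bound then gives [g y < g x + d / (2 tau)], which is negative for small [d].
   The radius is at least [tau |v|], and [|v|] is bounded below near [p]. *)
Lemma inner_ball_sublevel Om (U : set 'rV[R]_n) (g : 'rV[R]_n -> R) p :
  open U -> U p -> Ck_on 2 U g -> (exists i, dpartial i g p != 0) ->
  (forall x, U x -> (Om x <-> g x < 0)) ->
  exists2 s : R, 0 < s & \forall x \near p, Om x -> in_inner_ball Om s x.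
Proof.
move=> oU Up C2 [i0 gi0] OmE.
have [e e0 [L L0 [eU taylor]]] := second_order_upper_bound oU Up C2.
have cg i : {for p, continuous (dpartial i g)} by have [] := C2 [:: i] isT p Up.
pose G := \sum_i (`|dpartial i g p| + 1) ^+ 2.
have G0 : 0 <= G by apply: sumr_ge0 => i _; exact: sqr_ge0.
pose m := (`|dpartial i0 g p| / 2) ^+ 2.
have m0 : 0 < m by rewrite exprn_gt0// divr_gt0// normr_gt0.
have nearG : \forall x \near p, sqnorm (grad g x) <= G.
  have : \forall x \near p, forall i, `|dpartial i g x| <= `|dpartial i g p| + 1.
    apply: (@filter_forall _ _
      (fun i x => is_true (`|dpartial i g x| <= `|dpartial i g p| + 1)) (nbhs p)).
    by move=> i; exact: (near_abs_le (cg i)).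
  apply: filterS => x h; apply: ler_sum => i _.
  by rewrite mxE -real_normK ?num_real// lerXn2r ?nnegrE ?addr_ge0.
have nearm : \forall x \near p, m <= sqnorm (grad g x).
  have : \forall x \near p, `|dpartial i0 g p| / 2 <= `|dpartial i0 g x|.
    have := cvgr_norm_ge _ (cg i0); apply.
    by rewrite ltr_pdivrMr// ltr_pMr ?normr_gt0// ltr1n.
  apply: filterS => x h; rewrite /sqnorm (bigD1 i0)//= [grad _ _ _ _]mxE.
  apply: (@le_trans _ _ (dpartial i0 g x ^+ 2)).
    by rewrite -[leRHS]real_normK ?num_real// lerXn2r ?nnegrE// divr_ge0.
  by rewrite lerDl; apply: sumr_ge0 => i _; exact: sqr_ge0.
(* The first bound makes the quadratic term harmless. The second keeps the ball,
   whose radius is close to tau |v|, in the region where the Taylor bound holds. *)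
pose tau := Num.min (2 * (L + 1))^-1 (e / (8 * (G + 1))).
have tau0 : 0 < tau by rewrite lt_min !invr_gt0 !mulr_gt0 ?invr_gt0//; nra.
have tauL : 2 * tau * L <= 1.
  have : tau <= (2 * (L + 1))^-1 by rewrite ge_min lexx.
  rewrite -[_^-1]mul1r ler_pdivlMr; last by nra.
  nra.
have tauG : 64 * (tau ^+ 2 * G) <= e ^+ 2.
  have : tau <= e / (8 * (G + 1)) by rewrite ge_min lexx orbT.
  rewrite ler_pdivlMr; last by nra.
  move=> h.
  have : (tau * (8 * (G + 1))) ^+ 2 <= e ^+ 2 by rewrite lerXn2r ?nnegrE//; nra.
  apply: le_trans; rewrite exprMn -subr_ge0.
  rewrite (_ : _ - _ = tau ^+ 2 * (64 * (G ^+ 2 + G + 1))); last by ring.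
  by rewrite mulr_ge0 ?sqr_ge0//; nra.
exists (tau ^+ 2 * m); first by rewrite mulr_gt0// exprn_gt0.
have nearB : \forall x \near p, ball p (e / 2) x.
  by apply: nbhsx_ballx; rewrite divr_gt0.
near=> x => Omx.
have px2 : ball p (e / 2) x by near: x.
have px : ball p e x by apply: le_ball px2; lra.
have xG : sqnorm (grad g x) <= G by near: x.
have xm : m <= sqnorm (grad g x) by near: x.
have gx0 : g x < 0 by apply/OmE => //; exact: eU.
pose v := grad g x.
pose d := Num.min (e ^+ 2 / 32) (- tau * g x).
have d0 : 0 < d.
  by rewrite lt_min divr_gt0 ?exprn_gt0//= mulNr oppr_gt0 pmulr_rlt0.
have d1 : d <= e ^+ 2 / 32 by rewrite ge_min lexx.
have d2 : d <= - tau * g x by rewrite ge_min lexx orbT.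
apply: (@in_inner_ball_shrink _ (tau ^+ 2 * sqnorm v + d)).
  apply/andP; split; first by rewrite mulr_gt0// exprn_gt0.
  have : tau ^+ 2 * m <= tau ^+ 2 * sqnorm v by rewrite ler_wpM2l ?sqr_ge0.
  lra.
exists (x - tau *: v).
  by rewrite /eball/= opprB addrC subrK sqnormZ; lra.
move=> y; rewrite /eball/= opprB addrCA [_ + (y - x)]addrC => ya.
have yxE : y - x = (y - x + tau *: v) - tau *: v by rewrite addrK.
have yx2 : sqnorm (y - x) < (e / 2) ^+ 2.
  have : sqnorm (y - x) <= 2 * sqnorm (y - x + tau *: v) + 2 * sqnorm (tau *: v).
    have := sqnorm_ge0 ((y - x + tau *: v) + tau *: v).
    rewrite [in X in _ -> X <= _]yxE sqnormD sqnormB; lra.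
  rewrite sqnormZ exprMn => h.
  have : tau ^+ 2 * sqnorm v <= tau ^+ 2 * G by rewrite ler_wpM2l ?sqr_ge0.
  nra.
have yx : `|y - x| < e / 2.
  have := le_lt_trans (norm_sqr_le_sqnorm (y - x)) yx2.
  by rewrite ltr_pXn2r ?nnegrE ?divr_ge0 ?(ltW e0).
have py : ball p e y.
  rewrite [X in ball _ X]splitr; apply: (ball_triangle px2).
  by rewrite mx_norm_ball /ball_ /= distrC.
apply/OmE; first exact: eU.
have := taylor _ _ px py.
move: ya; rewrite (sqnormD (y - x)) sqnormZ dotpZr.
have -> : dotp (y - x) v = dotp v (y - x) by apply: eq_bigr => i _; rewrite mulrC.
have := sqnorm_ge0 (y - x).
rewrite -/v; set S := sqnorm (y - x); set D := dotp _ _ => S0 h1 h2.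
rewrite -(pmulr_rlt0 _ tau0).
have : tau * g y <= tau * (g x + D + L * S) by rewrite ler_pM2l.
nra.
Unshelve. all: by end_near.
Qed.

(** The condition holds near every point with some radius: trivially inside and
   outside the closure, by the sublevel description at the boundary. Inner balls can
   be shrunk, so compactness gives a common radius. *)
Theorem interior_ball_condition Om :
  open Om -> bounded_set Om -> smooth_boundary Om ->
  exists2 s : R, 0 < s & forall x, Om x -> in_inner_ball Om s x.
Proof.
move=> oOm [M [_ OmM]] smooth.
have Mb x : Om x -> `|x| <= M + 1 by apply: OmM; rewrite ltrDl.
pose K := [set v : 'rV[R]_n | forall i, v 0 i \in `[(- (M + 1)), (M + 1)]].
have cK : compact K.
  by apply: (@rV_compact _ _ (fun=> `[(- (M + 1)), (M + 1)]%classic)) => _; exact: segment_compact.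
move/compact_near_coveringP : cK => cK.
have loc p : exists2 s : R, 0 < s & \forall x \near p, Om x -> in_inner_ball Om s x.
  have [Omp|Omp] := pselect (Om p).
    have : nbhs p Om by exact: open_nbhs_nbhs.
    move=> /nbhs_ballP[e /= e0 eOm]; exists ((e / 2) ^+ 2); first by rewrite exprn_gt0// divr_gt0.
    have : \forall x \near p, ball p (e / 2) x by apply: nbhsx_ballx; rewrite divr_gt0.
    apply: filterS => x px _; exists x.
      by rewrite /eball/= subrr -(scale0r 0) sqnormZ expr0n mul0r exprn_gt0// divr_gt0.
    move=> y; rewrite /eball/= => yx2; apply: eOm.
    rewrite [X in ball _ X]splitr; apply: (ball_triangle px).
    rewrite mx_norm_ball /ball_ /= distrC.
    have := le_lt_trans (norm_sqr_le_sqnorm (y - x)) yx2.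
    by rewrite ltr_pXn2r ?nnegrE ?divr_ge0 ?(ltW e0).
  have [clp|ncl] := pselect (closure Om p); last first.
    exists 1 => //.
    have : \forall x \near p, ~ closure Om x.
      by apply: open_nbhs_nbhs; split => //; apply: closed_openC; exact: closed_closure.
    by apply: filterS => x nx /subset_closure.
  have [] := smooth p; first by split=> // /interior_subset.
  move=> U [g [[oU Up] sg gn0 OmE _]].
  exact: (inner_ball_sublevel oU Up (sg 2%N) (gn0 _ Up) OmE).
have : \forall s \near (0:R)^'+, K `<=` [set x | Om x -> in_inner_ball Om s x].
  apply: (cK _ _ (fun s x => Om x -> in_inner_ball Om s x)) => p _.
  have [s s0 sP] := loc p.
  near=> x s' => /= Omx; apply: (@in_inner_ball_shrink _ s).
    apply/andP; split; near: s'; [exact: nbhs_right_gt|exact: nbhs_right_le].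
  by move: Omx; near: x.
move=> h.
have [s [s0 sK]] : exists s : R, 0 < s /\ K `<=` [set x | Om x -> in_inner_ball Om s x].
  apply: (@filter_ex _ (0:R)^'+); apply: filterI => //; exact: nbhs_right_gt.
exists s => // x Omx; apply: sK => // i.
rewrite in_itv/= -ler_norml; apply: le_trans (Mb _ Omx); exact: coord_le_norm.
Unshelve. all: by end_near.
Qed.

End InteriorBall.

(** * Averaging against the density *)
Section Average.
Context (R : realType) (n : nat) (J : 'rV[R]_n -> R).
Hypotheses (J_continuous : continuous J) (J_ge0 : forall x, 0 <= J x)
  (J_supp : compactly_supported J) (J_mass : integral_Rn setT J = 1).
Implicit Types (f g : 'rV[R]_n -> R).

Definition average f : R := integral_Rn setT (fun z => J z * f z).

Let mu := lebesgue_tuple R n.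

Lemma integrable_density : mu.-integrable setT (EFin \o (J \o @row_of_tuple R n)).
Proof.
have mJ : measurable_fun setT (J \o @row_of_tuple R n) by exact: measurable_continuous_row.
apply/integrableP; split; first exact/measurable_EFinP.
under eq_integral do rewrite /= ger0_norm//.
move: J_mass; rewrite /integral_Rn preimage_setT /Rintegral.
case: (\int[_]_(_ in _) _)%E => [r _|/=/eqP|/=/eqP]; first exact: ltry.
  by rewrite eq_sym oner_eq0.
by rewrite eq_sym oner_eq0.
Qed.

(** Bounded on the compact support of [J], hence dominated by a multiple of [J]. *)
Lemma integrable_average f : continuous f ->
  mu.-integrable setT (EFin \o ((fun z => J z * f z) \o @row_of_tuple R n)).
Proof.
move=> cf.
have : compact (f @` closure [set z | J z != 0]).
  by apply: continuous_compact => //; exact: continuous_subspaceT.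
move=> /compact_bounded[M [_ fM]].
have {}fM z : J z != 0 -> `|f z| <= M + 1.
  by move=> Jz; apply: (fM (M + 1)); [rewrite ltrDl|exists z => //; exact: subset_closure].
apply: (@le_integrable _ _ _ mu setT measurableT _
  (EFin \o (fun t => (M + 1) * J (row_of_tuple t)))).
- apply/measurable_EFinP; apply: measurable_continuous_row => x.
  by apply: continuousM; [exact: J_continuous|exact: cf].
- move=> t _ /=; rewrite lee_fin !normrM (ger0_norm (J_ge0 _)) mulrC.
  have [->|Jz] := eqVneq (J (row_of_tuple t)) 0; first by rewrite !mulr0.
  by rewrite ler_wpM2r//; apply: le_trans (fM _ Jz) _; exact: ler_norm.
exact: (integrableZl measurableT (M + 1) integrable_density).
Qed.

Lemma le_average f g : continuous f -> continuous g ->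
  (forall z, J z != 0 -> f z <= g z) -> average f <= average g.
Proof.
move=> cf cg fg; rewrite /average /integral_Rn preimage_setT.
apply: le_Rintegral => //; [exact: integrable_average|exact: integrable_average|].
move=> t _ /=; have [->|Jt] := eqVneq (J (row_of_tuple t)) 0; first by rewrite !mul0r.
by rewrite ler_wpM2l// fg.
Qed.

Lemma averageD f g : continuous f -> continuous g ->
  average (fun z => f z + g z) = average f + average g.
Proof.
move=> cf cg; rewrite /average /integral_Rn preimage_setT.
under eq_Rintegral do rewrite mulrDr.
by apply: RintegralD => //; exact: integrable_average.
Qed.

Lemma averageZ (c : R) f : continuous f -> average (fun z => c * f z) = c * average f.
Proof.
move=> cf; rewrite /average /integral_Rn preimage_setT.
under eq_Rintegral do rewrite mulrCA.
by apply: RintegralZl => //; exact: integrable_average.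
Qed.

Lemma average_cst (c : R) : average (fun=> c) = c.
Proof.
have cc : continuous (fun _ : 'rV[R]_n => 1 : R) by exact: cst_continuous.
rewrite -[in LHS](mulr1 c) averageZ//.
rewrite (_ : average _ = 1) ?mulr1// -[RHS]J_mass /average.
by under eq_fun do rewrite mulr1.
Qed.

Lemma dotp_continuous (l : 'rV[R]_n) : continuous (dotp l).
Proof.
apply: continuous_big => [|i _ x]; first exact: add_continuous.
by apply: continuousM; [exact: cst_continuous|exact: coord_continuous].
Qed.

Lemma average_dotp (l : 'rV[R]_n) :
  (forall i : 'I_n, integral_Rn setT (fun x => J x * x 0 i) = 0) ->
  average (dotp l) = 0.
Proof.
move=> J_center; rewrite /dotp.
have : forall s : seq 'I_n, average (fun z => \sum_(i <- s) l 0 i * z 0 i) = 0.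
  elim=> [|i s IH]; first by under eq_fun do rewrite big_nil; exact: average_cst.
  under eq_fun do rewrite big_cons.
  have ci : continuous (fun z : 'rV[R]_n => z 0 i) by move=> x; exact: coord_continuous.
  rewrite averageD ?IH ?addr0.
  - by rewrite averageZ// /average J_center mulr0.
  - by move=> x; apply: continuousM; [exact: cst_continuous|exact: ci].
  - apply: continuous_big => [|j _ x]; first exact: add_continuous.
    by apply: continuousM; [exact: cst_continuous|exact: coord_continuous].
exact.
Qed.

Definition pospart (r : R) : R := Num.max r 0.

Lemma pospart_ge0 r : 0 <= pospart r. Proof. by rewrite le_max lexx orbT. Qed.

Lemma le_pospart r r' : r <= r' -> pospart r <= pospart r'.
Proof. by move=> rr'; rewrite /pospart ge_max !le_max rr' lexx !orbT. Qed.

Lemma pospartP r : (0 <= r /\ pospart r = r) \/ (r <= 0 /\ pospart r = 0).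
Proof.
case: (leP 0 r) => r0; first by left; split=> //; rewrite /pospart; apply/max_idPl.
by right; rewrite ltW// /pospart; split=> //; apply/max_idPr/ltW.
Qed.

Lemma pospart_continuous f : continuous f -> continuous (fun z => pospart (f z)).
Proof. by move=> cf x; apply: continuous_max; [exact: cf|exact: cst_continuous]. Qed.

Lemma sqr_continuous f : continuous f -> continuous (fun z => f z ^+ 2).
Proof. by move=> cf x; exact: (continuousM (cf x) (cf x)). Qed.

(** [J] is at least [J 0 / 2] on a cube around 0. In it, the box of the points whose
   coordinates are bounded away from 0 and have the signs of those of [l] has a volume
   independent of [l], and there [l.z] is at least a multiple of the l^1 norm of [l]. *)
Lemma average_pospart_dotp_ge : 0 < J 0 ->
  exists2 k : R, 0 < k & forall l, k * sqnorm l <= average (fun z => pospart (dotp l z) ^+ 2).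
Proof.
move=> J0.
have : \forall z \near (0 : 'rV[R]_n), J 0 / 2 <= J z.
  have /cvgr_ge : J z @[z --> (0 : 'rV[R]_n)] --> J 0 by exact: J_continuous.
  by apply; rewrite ltr_pdivrMr// ltr_pMr// ltr1n.
move=> /nbhs_ballP[d /= d0 Jd].
have d4 : 0 < d / 4 by rewrite divr_gt0.
exists (J 0 / 2 * (d / 4) ^+ 2 * (d / 4) ^+ n).
  by rewrite !mulr_gt0 ?invr_gt0 ?exprn_gt0.
move=> l.
pose A (i : 'I_n) : set (measurableTypeR R) :=
  if 0 <= l 0 i then `[d / 4, d / 2]%classic else `[- (d / 2), - (d / 4)]%classic.
have mA i : measurable (A i) by rewrite /A; case: ifP => _; exact: measurable_itv.
have lA i : lebesgue_measure (A i) = (d / 4)%:E.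
  rewrite /A; case: ifP => _; rewrite lebesgue_measure_itv/= lte_fin.
    by rewrite ifT ?EFinB//; [congr (_%:E); lra|lra].
  by rewrite ifT ?EFinB//; [congr (_%:E); lra|lra].
pose B := [set t : n.-tuple (measurableTypeR R) | forall i, A i (tnth t i)].
have muB : mu B = ((d / 4) ^+ n)%:E.
  rewrite /mu lebesgue_tuple_box//; under eq_bigr do rewrite lA.
  by rewrite prodEFin prodr_const card_ord.
have mB : measurable B.
  rewrite (_ : B = \bigcap_(i in [set: 'I_n]) ((fun t => tnth t i) @^-1` A i)).
    apply: fin_bigcap_measurable => // i _.
    by rewrite -[X in measurable X]setTI; exact: measurable_tnth.
  by apply/seteqP; split=> t /= h i; [move=> _|]; exact: h.
have iB : mu.-integrable setT (EFin \o (\1_B : _ -> R)).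
  apply/integrableP; split; first by apply/measurable_EFinP; exact: measurable_indic.
  under eq_integral do rewrite /= ger0_norm//.
  by rewrite integral_indic// setIT [X in (X < _)%E]muB ltry.
rewrite /average /integral_Rn preimage_setT.
have -> : J 0 / 2 * (d / 4) ^+ 2 * (d / 4) ^+ n * sqnorm l =
    \int[mu]_(t in setT) (J 0 / 2 * (d / 4) ^+ 2 * sqnorm l * \1_B t).
  rewrite RintegralZl//.
  by rewrite [X in _ = _ * X]/Rintegral integral_indic// setIT [X in fine X]muB/= mulrAC.
apply: le_Rintegral => //.
- exact: (integrableZl measurableT (J 0 / 2 * (d / 4) ^+ 2 * sqnorm l) iB).
- exact: (integrable_average (sqr_continuous (pospart_continuous (@dotp_continuous l)))).
move=> t _ /=; rewrite indicE.
case: (boolP (t \in B)) => [/set_mem Bt|_]; last by rewrite mulr0 mulr_ge0// sqr_ge0.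
rewrite mulr1 -mulrA.
apply: ler_pM => //; first by rewrite divr_ge0// ltW.
- by rewrite mulr_ge0 ?sqr_ge0// sqnorm_ge0.
- apply: Jd; split=> // k i; rewrite (ord1 k) !mxE /ball/= sub0r normrN ltr_norml.
  by move: (Bt i); rewrite /A; case: ifP => _; rewrite /= in_itv/= => /andP[? ?];
    apply/andP; split; lra.
have lz i : d / 4 * `|l 0 i| <= l 0 i * (row_of_tuple t) 0 i.
  rewrite mxE; move: (Bt i); rewrite /A; case: ifPn => li; rewrite /= in_itv/= => /andP[? ?].
    by rewrite ger0_norm// mulrC ler_wpM2l.
  move: li; rewrite -ltNge => li; rewrite ltr0_norm//.
  by nra.
pose S := \sum_i `|l 0 i|.
have S0 : 0 <= S by apply: sumr_ge0.
have SS : sqnorm l <= S ^+ 2.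
  rewrite expr2 /S mulr_suml; apply: ler_sum => i _.
  rewrite -real_normK ?num_real// expr2 ler_wpM2l//.
  by rewrite (bigD1 i)//= lerDl; apply: sumr_ge0.
have Sd : d / 4 * S <= dotp l (row_of_tuple t).
  by rewrite /S mulr_sumr; apply: ler_sum => i _; exact: lz.
have Sp : d / 4 * S <= pospart (dotp l (row_of_tuple t)) by rewrite le_max Sd.
apply: (@le_trans _ _ ((d / 4 * S) ^+ 2)).
  by rewrite [leRHS]exprMn ler_wpM2l ?sqr_ge0.
by rewrite lerXn2r ?nnegrE ?pospart_ge0// mulr_ge0// ltW.
Qed.

End Average.

(** * The inequality for one bump *)
Section Bump.
Context (R : realType) (n : nat).
Implicit Types (a x y z : 'rV[R]_n) (s : R).

Definition bump s a x : R := pospart (s - sqnorm (x - a)) ^+ 2.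

Lemma bump_ge0 s a x : 0 <= bump s a x. Proof. exact: sqr_ge0. Qed.

Lemma bump_gt0 s a x : eball a s x -> 0 < bump s a x.
Proof.
rewrite /eball/= -subr_gt0 => q0; rewrite /bump exprn_gt0//.
by rewrite lt_max q0.
Qed.

Lemma bump_eq0 s a x : ~ eball a s x -> bump s a x = 0.
Proof.
move=> /negP; rewrite -leNgt -subr_le0 => q0.
by rewrite /bump /pospart (max_idPr q0) expr0n.
Qed.

Lemma bump_continuous s a : continuous (bump s a).
Proof.
apply: sqr_continuous; apply: pospart_continuous => x.
have c1 : {for x, continuous (fun y : 'rV[R]_n => sqnorm (y - a))}.
  apply: continuous_comp; last exact: sqnorm_continuous.
  exact: (continuousB (f := id) (fun A => id) (@cst_continuous _ _ a x)).
exact: (continuousB (@cst_continuous _ _ s x) c1).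
Qed.

(** Two lower bounds are combined. The inequality
   [(q + w)_+^2 >= q^2 + 2 q w + w_+^2] holds for [q >= 0]; the shift by [b] is handled by
   Young's inequality [2 u b <= eta u^2 + b^2 / eta]. *)
Lemma pospart_sqr_perturb (q w b eta : R) : 0 <= q -> 0 <= b -> 0 < eta <= 1 ->
  (1 - eta) * (q ^+ 2 + 2 * q * w + pospart w ^+ 2) - b ^+ 2 / eta <=
  pospart (q + w - b) ^+ 2.
Proof.
move=> q0 b0 /andP[eta0 eta1].
have h1 : q ^+ 2 + 2 * q * w + pospart w ^+ 2 <= pospart (q + w) ^+ 2.
  by case: (pospartP (q + w)) => -[? ->]; case: (pospartP w) => -[? ->]; nra.
have [c -> c0] : exists2 c, b = eta * c & 0 <= c.
  by exists (b / eta); rewrite ?divr_ge0 ?(ltW eta0)// mulrCA divff ?mulr1// gt_eqF.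
have -> : (eta * c) ^+ 2 / eta = eta * c ^+ 2 by field; rewrite gt_eqF.
apply: (@le_trans _ _ ((1 - eta) * pospart (q + w) ^+ 2 - eta * c ^+ 2)).
  by rewrite lerD2r ler_wpM2l// subr_ge0.
have ec : 0 <= eta * c by rewrite mulr_ge0// ltW.
have e2 : eta ^+ 2 <= eta by nra.
have : 0 <= eta * c ^+ 2 by rewrite mulr_ge0 ?sqr_ge0// ltW.
case: (pospartP (q + w)) => -[u0 ->]; case: (pospartP (q + w - eta * c)) => -[v0 ->]; last 2 first.
- by rewrite expr0n/=; nra.
- by rewrite expr0n/=; nra.
- set u := q + w in u0 v0 *.
  have : 0 <= eta * (u - c) ^+ 2 by rewrite mulr_ge0 ?sqr_ge0// ltW.
  have : 0 <= (eta * c) ^+ 2 by exact: sqr_ge0.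
  nra.
- set u := q + w in u0 v0 *.
  have : u ^+ 2 <= (eta * c) ^+ 2 by rewrite lerXn2r ?nnegrE//; lra.
  have : (eta * c) ^+ 2 <= eta * c ^+ 2 by rewrite exprMn ler_wpM2r ?sqr_ge0.
  have : 0 <= eta * u ^+ 2 by rewrite mulr_ge0 ?sqr_ge0// ltW.
  rewrite expr0n/=; nra.
Qed.

Context (J : 'rV[R]_n -> R).
Hypotheses (J_continuous : continuous J) (J_ge0 : forall x, 0 <= J x)
  (J_supp : compactly_supported J) (J0_gt0 : 0 < J 0)
  (J_mass : integral_Rn setT J = 1)
  (J_center : forall i : 'I_n, integral_Rn setT (fun x => J x * x 0 i) = 0).

Lemma affine_continuous x (e : R) : continuous (fun z => x - e *: z).
Proof.
move=> z; have c2 : {for z, continuous (fun u : 'rV[R]_n => e *: u)} by exact: scaler_continuous.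
exact: (continuousB (@cst_continuous _ _ x z) c2).
Qed.

(** The pointwise lower bound for the bump is a combination of a constant, a linear
   form and the square of the positive part of that linear form, whose averages are
   known or bounded below. The threshold depends on [s] and [J] only. *)
Lemma average_bump_ge s : 0 < s ->
  exists2 e0 : R, 0 < e0 & forall e a x, 0 < e <= e0 ->
    (1 - e) * bump s a x <= average J (fun z => bump s a (x - e *: z)).
Proof.
move=> s0.
have [k k0 kP] := average_pospart_dotp_ge J_continuous J_ge0 J_supp J_mass J0_gt0.
have [B B1 suppB] : exists2 B : R, 1 <= B & forall z, J z != 0 -> sqnorm z <= B.
  have : compact (@sqnorm R n @` closure [set z | J z != 0]).
    apply: continuous_compact => //; apply: continuous_subspaceT; exact: sqnorm_continuous.
  move=> /compact_bounded[M [_ hM]]; exists (Num.max 1 (M + 1)); first by rewrite le_max lexx.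
  move=> z Jz; rewrite le_max; apply/orP; right.
  have := hM (M + 1); rewrite ltrDl ltr01 => /(_ isT (sqnorm z)) /=.
  move=> h; apply: le_trans (ler_norm _) (h _).
  by exists z => //; exact: subset_closure.
exists (Num.min 1 (Num.min (s / (4 * B)) (k * s / (2 * B ^+ 2)))).
  rewrite !lt_min ltr01/= !divr_gt0 ?mulr_gt0 ?exprn_gt0//; lra.
move=> e a x /andP[e0]; rewrite !le_min => /andP[e1 /andP[e2 e3]].
have cb : continuous (fun z => bump s a (x - e *: z)).
  by move=> z; exact: (continuous_comp (@affine_continuous x e z) (@bump_continuous s a _)).
(* Outside the ball the left side vanishes. *)
have [q0|q0] := leP (s - sqnorm (x - a)) 0.
  rewrite [X in _ * X]/bump /pospart (max_idPr q0) expr0n mulr0.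
  rewrite -(average_cst J_continuous J_ge0 J_supp J_mass 0).
  apply: le_average => //; first exact: cst_continuous.
  by move=> z _; exact: bump_ge0.
rewrite [X in _ * X]/bump /pospart (max_idPl (ltW q0)).
set q := s - _ in q0 *; pose l := x - a.
pose V := average J (fun z => pospart (dotp l z) ^+ 2).
have cd : continuous (dotp l) by exact: dotp_continuous.
have cp : continuous (fun z => pospart (dotp l z) ^+ 2).
  by apply: sqr_continuous; apply: pospart_continuous.
pose C0 := (1 - e / 2) * q ^+ 2 - 2 * e ^+ 3 * B ^+ 2.
pose C1 := (1 - e / 2) * (4 * q * e).
pose C2 := (1 - e / 2) * (4 * e ^+ 2).
have c1 : continuous (fun z => C1 * dotp l z).
  by move=> z; exact: (continuousM (@cst_continuous _ _ C1 z) (cd z)).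
have c2 : continuous (fun z => C2 * pospart (dotp l z) ^+ 2).
  by move=> z; exact: (continuousM (@cst_continuous _ _ C2 z) (cp z)).
have c12 : continuous (fun z => C1 * dotp l z + C2 * pospart (dotp l z) ^+ 2).
  by move=> z; exact: (continuousD (c1 z) (c2 z)).
have avgE : average J (fun z => C0 + (C1 * dotp l z + C2 * pospart (dotp l z) ^+ 2)) = C0 + C2 * V.
  rewrite (averageD J_continuous J_ge0 J_supp J_mass (@cst_continuous _ _ C0) c12).
  rewrite (averageD J_continuous J_ge0 J_supp J_mass c1 c2).
  rewrite (averageZ J_continuous J_ge0 J_supp J_mass C1 cd).
  rewrite (averageZ J_continuous J_ge0 J_supp J_mass C2 cp).
  by rewrite average_cst// average_dotp// mulr0 add0r.
have : average J (fun z => C0 + (C1 * dotp l z + C2 * pospart (dotp l z) ^+ 2)) <=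
    average J (fun z => bump s a (x - e *: z)).
  apply: le_average => //.
    by move=> z; exact: (continuousD (@cst_continuous _ _ C0 z) (c12 z)).
  move=> z Jz.
  have -> : bump s a (x - e *: z) = pospart (q + 2 * e * dotp l z - e ^+ 2 * sqnorm z) ^+ 2.
    rewrite /bump addrAC -/l (sqnormB l) sqnormZ dotpZr /q -/l; congr (pospart _ ^+ 2); ring.
  have posM : pospart (2 * e * dotp l z) = 2 * e * pospart (dotp l z).
    by rewrite /pospart -[in LHS](mulr0 (2 * e)) maxr_pMr//; nra.
  apply: (@le_trans _ _ (pospart (q + 2 * e * dotp l z - e ^+ 2 * B) ^+ 2)); last first.
    rewrite lerXn2r ?nnegrE ?pospart_ge0// le_pospart// lerD2l lerN2.
    by rewrite ler_wpM2l ?sqr_ge0// suppB.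
  have e21 : 0 < e / 2 <= 1 by apply/andP; split; lra.
  have eB : 0 <= e ^+ 2 * B by rewrite mulr_ge0 ?sqr_ge0//; lra.
  apply: le_trans (pospart_sqr_perturb (2 * e * dotp l z) (ltW q0) eB e21).
  rewrite posM /C0 /C1 /C2 le_eqVlt; apply/orP; left; apply/eqP.
  by field; rewrite gt_eqF.
rewrite avgE; apply: le_trans.
have lV : k * (s - q) <= V by apply: le_trans (kP l); rewrite /q opprB addrC subrK.
have sq : 0 <= s - q by rewrite /q opprB addrC subrK sqnorm_ge0.
(* s - q is the square norm of l: one of q and s - q is at least s / 2. *)
have main : 2 * e ^+ 2 * B ^+ 2 <= q ^+ 2 / 2 + 2 * e * (k * (s - q)).
  have B0 : 0 < B by lra.
  have [qs|qs] := leP (s / 2) q.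
    have : e * (4 * B) <= s by rewrite -ler_pdivlMr ?mulr_gt0.
    move=> h; have : (e * (4 * B)) ^+ 2 <= s ^+ 2 by rewrite lerXn2r ?nnegrE//; nra.
    have : (s / 2) ^+ 2 <= q ^+ 2 by rewrite lerXn2r ?nnegrE//; nra.
    have : 0 <= 2 * e * (k * (s - q)) by rewrite !mulr_ge0// ltW.
    rewrite !exprMn; nra.
  have : e * (2 * B ^+ 2) <= k * s by rewrite -ler_pdivlMr ?mulr_gt0 ?exprn_gt0.
  move=> h; have : e * (e * (2 * B ^+ 2)) <= e * (k * s) by rewrite ler_pM2l.
  have : e * k * (s / 2) <= e * k * (s - q) by rewrite ler_pM2l ?mulr_gt0//; lra.
  have := sqr_ge0 q.
  nra.
have : 2 * e ^+ 2 * (k * (s - q)) <= C2 * V.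
  apply: ler_pM => //.
  - by rewrite mulr_ge0 ?sqr_ge0.
  - by rewrite mulr_ge0// ltW.
  - by rewrite /C2; have := sqr_ge0 e; nra.
have : e * (2 * e ^+ 2 * B ^+ 2) <= e * (q ^+ 2 / 2 + 2 * e * (k * (s - q))).
  by rewrite ler_pM2l.
rewrite /C0 !exprS expr0; nra.
Qed.

End Bump.

(** * Dyadic means *)
Section DyadicMean.
Context (R : realType).
Implicit Types (u v : nat -> R).

Definition dyadic (k : nat) : R := 1 / (2 ^ k.+1)%:R.

Lemma dyadic_gt0 k : 0 < dyadic k.
Proof. by rewrite divr_gt0// ltr0n expn_gt0. Qed.

Lemma cvg_series_dyadic : series dyadic @ \oo --> (1 : R).
Proof.
have := @cvg_geometric_series_half R 1 0; rewrite expr0 divr1.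
by under [X in series X]eq_fun do rewrite addn1.
Qed.

Lemma is_cvg_series_dyadic : cvgn (series dyadic).
Proof. by apply/cvg_ex; exists 1; exact: cvg_series_dyadic. Qed.

Lemma is_cvg_seriesZ_dyadic (C : R) : cvgn (series (fun k => C * dyadic k)).
Proof.
rewrite (_ : (fun k => C * dyadic k) = C *: (dyadic : R^o^nat)); last exact/funext.
exact: is_cvg_seriesZ is_cvg_series_dyadic.
Qed.

Definition dmean u : R := limn (series (fun k => dyadic k * u k)).

Lemma is_cvg_dmean u (C : R) : (forall k, `|u k| <= C) ->
  cvgn (series (fun k => dyadic k * u k)).
Proof.
move=> uC; apply: (@normed_cvg _ R^o).
apply: (@series_le_cvg _ _ (fun k => C * dyadic k)) => [k|k|k|].
- exact: normr_ge0.
- by rewrite mulr_ge0 ?(ltW (dyadic_gt0 k))//; apply: le_trans (uC 0%N).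
- rewrite /= normrM (gtr0_norm (dyadic_gt0 k)) mulrC.
  by rewrite ler_wpM2r// ltW// dyadic_gt0.
- exact: is_cvg_seriesZ_dyadic.
Qed.

(** The dyadic weights add up to 1. *)
Lemma dmean_norm_le u (C : R) : (forall k, `|u k| <= C) -> `|dmean u| <= C.
Proof.
move=> uC; have cu := is_cvg_dmean uC.
have hC : cvgn (series (fun k => C * dyadic k)) by exact: is_cvg_seriesZ_dyadic.
have cC : limn (series (fun k => C * dyadic k)) = C.
  rewrite [LHS](lim_seriesZ C is_cvg_series_dyadic).
  by rewrite (cvg_lim (@Rhausdorff R) cvg_series_dyadic) [LHS]mulr1.
have b k : `|dyadic k * u k| <= C * dyadic k.
  rewrite normrM (gtr0_norm (dyadic_gt0 k)) mulrC.
  by rewrite ler_wpM2r// ltW// dyadic_gt0.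
rewrite ler_norml; apply/andP; split; last first.
  by rewrite -[leRHS]cC; apply: lim_series_le => // k; apply: le_trans (ler_norm _) (b k).
rewrite -[X in - X]cC -lim_seriesN//.
apply: lim_series_le => //; first by rewrite is_cvg_seriesN.
by move=> k; have := b k; rewrite ler_norml => /andP[].
Qed.

Lemma dmeanB u v (C D : R) : (forall k, `|u k| <= C) -> (forall k, `|v k| <= D) ->
  dmean (fun k => u k - v k) = dmean u - dmean v.
Proof.
move=> uC vD; rewrite /dmean -(lim_seriesB (is_cvg_dmean uC) (is_cvg_dmean vD)).
by congr (limn (series _)); apply/funext => k; rewrite mulrBr.
Qed.

Lemma dmeanZ (c : R) u (C : R) : (forall k, `|u k| <= C) ->
  dmean (fun k => c * u k) = c * dmean u.
Proof.
move=> uC; rewrite /dmean -[RHS](lim_seriesZ c (is_cvg_dmean uC)).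
by congr (limn (series _)); apply/funext => k; rewrite mulrCA.
Qed.

Lemma dmean_ge_partial u (C : R) N : (forall k, `|u k| <= C) -> (forall k, 0 <= u k) ->
  \sum_(0 <= k < N) dyadic k * u k <= dmean u.
Proof.
move=> uC u0; apply: (nondecreasing_cvgn_le _ (is_cvg_dmean uC) N).
by apply: nondecreasing_series => k _ _; rewrite mulr_ge0// ltW// dyadic_gt0.
Qed.

End DyadicMean.

(** * Regularity of a dyadic mean of functions *)
Section MeanRegularity.
Context (R : realType) (n : nat) (F G : nat -> 'rV[R]_n -> R).

Lemma dmean_continuous :
  (forall x, exists C : R, forall k, `|F k x| <= C) ->
  (forall x, exists K : R, forall k y, `|y - x| <= 1 -> `|F k y - F k x| <= K * `|y - x|) ->
  continuous (fun x => dmean (F ^~ x)).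
Proof.
move=> bF lF x; have [K KP] := lF x.
have [Cx Cxb] := bF x.
have nearx (r : R) : 0 < r -> \forall y \near x, `|y - x| <= r.
  move=> r0; have : \forall y \near x, ball x r y by exact: nbhsx_ballx.
  by apply: filterS => y; rewrite mx_norm_ball /ball_/= distrC => /ltW.
apply/(cvgrPdist_le (FF := nbhs_filter x)) => e e0; near=> y.
have yx1 : `|y - x| <= 1 by near: y; exact: nearx.
have yxe : `|y - x| <= e / (`|K| + 1).
  by near: y; apply: nearx; rewrite divr_gt0// ltr_wpDl.
have [Cy Cyb] := bF y.
rewrite distrC -(dmeanB Cyb Cxb); apply: dmean_norm_le => k.
apply: le_trans (KP k y yx1) _.
rewrite ler_pdivlMr ?ltr_wpDl// in yxe.
have := ler_norm K; have := normr_ge0 (y - x); nra.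
Unshelve. all: by end_near. Qed.

(** A first-order Taylor estimate with a quadratic error uniform in the index survives
   the summation, and it makes the difference quotients of the sum converge. *)
Lemma dmean_derive x i :
  (forall y, exists C : R, forall k, `|F k y| <= C) ->
  (exists C : R, forall k, `|G k x| <= C) ->
  (exists K : R, forall k (h : R), `|h| <= 1 ->
    `|F k (h *: delta_mx 0 i + x) - F k x - h * G k x| <= K * h ^+ 2) ->
  is_derive x (delta_mx 0 i) (fun y => dmean (F ^~ y)) (dmean (G ^~ x)).
Proof.
move=> bF [CG CGb] [K KP].
suff cv : (fun h : R => h^-1 *: (((fun y => dmean (F ^~ y)) \o shift x) (h *: delta_mx 0 i)
     - dmean (F ^~ x))) @ 0^' --> dmean (G ^~ x).
  split; first by apply/cvg_ex; exists (dmean (G ^~ x)).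
  by apply: cvg_lim => //; exact: Rhausdorff.
have [Cx Cxb] := bF x.
apply/cvgrPdist_le => e e0; near=> h.
have h0 : h != 0 by near: h; exact: nbhs_dnbhs_neq.
have h1 : `|h| <= 1.
  near: h; apply: dnbhs0_le; exact: ltr01.
have he : `|h| <= e / (`|K| + 1).
  near: h; apply: dnbhs0_le; by rewrite divr_gt0// ltr_wpDl.
have [Cy Cyb] := bF (h *: delta_mx 0 i + x).
have hG k : `|h * G k x| <= `|h| * CG by rewrite normrM ler_wpM2l.
have E : `|dmean (F ^~ (h *: delta_mx 0 i + x)) - dmean (F ^~ x) - h * dmean (G ^~ x)|
    <= K * h ^+ 2.
  rewrite -(dmeanZ h CGb) -(dmeanB Cyb Cxb).
  rewrite -(@dmeanB _ (fun k => F k (h *: delta_mx 0 i + x) - F k x) _ (Cy + Cx) (`|h| * CG))//.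
    by apply: dmean_norm_le => k; exact: KP.
  by move=> k; apply: le_trans (ler_normB _ _) _; rewrite lerD.
rewrite distrC /= -[X in _ - X](mulKf h0) -[_ *: _]/(_ * _) -mulrBr normrM normfV.
rewrite ler_pdivrMl ?normr_gt0//; apply: le_trans E _.
rewrite -real_normK ?num_real// expr2 mulrA mulrC ler_wpM2l//.
rewrite ler_pdivlMr ?ltr_wpDl// in he.
have := ler_norm K; have := normr_ge0 h; nra.
Unshelve. all: by end_near. Qed.

End MeanRegularity.

(** * Regularity estimates on bumps *)
Section BumpRegularity.
Context (R : realType) (n : nat).
Implicit Types (a x y : 'rV[R]_n).

Lemma pospart_lipschitz (r t : R) : `|pospart r - pospart t| <= `|r - t|.
Proof.
rewrite ler_norml; have := ler_norm (r - t); have := ler_norm (t - r).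
rewrite [`|t - r|]distrC.
by case: (pospartP r) => -[? ->]; case: (pospartP t) => -[? ->] *; apply/andP; split; lra.
Qed.

Lemma pospart_sqr_derive (r t : R) :
  `|pospart r ^+ 2 - pospart t ^+ 2 - 2 * pospart t * (r - t)| <= (r - t) ^+ 2.
Proof.
rewrite ler_norml; have := sqr_ge0 r; have := sqr_ge0 t; have := sqr_ge0 (r - t).
case: (pospartP r) => -[r0 ->]; case: (pospartP t) => -[t0 ->] S1 S2 S3.
- by apply/andP; split; nra.
- have h : 0 <= r * - t by rewrite mulr_ge0// oppr_ge0.
  by apply/andP; split; nra.
- have h : 0 <= - r * t by rewrite mulr_ge0// oppr_ge0.
  by apply/andP; split; nra.
- by apply/andP; split; nra.
Qed.

Lemma sqnormB_lipschitz a x y (D : R) : `|x - a| <= D -> `|y - x| <= 1 ->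
  `|sqnorm (y - a) - sqnorm (x - a)| <= (\sum_(i < n) (2 * D + 1)) * `|y - x|.
Proof.
move=> xaD yx1; rewrite /sqnorm -sumrB mulr_suml.
apply: le_trans (ler_norm_sum _ _ _) _; apply: ler_sum => i _.
have -> : (y - a) 0 i ^+ 2 - (x - a) 0 i ^+ 2 =
    (2 * (x - a) 0 i + (y - x) 0 i) * (y - x) 0 i by rewrite !mxE; ring.
rewrite normrM; apply: ler_pM => //; last exact: coord_le_norm.
apply: le_trans (ler_normD _ _) _; apply: lerD.
  by rewrite normrM ger0_norm// ler_wpM2l//; apply: le_trans xaD; exact: coord_le_norm.
by apply: le_trans yx1; exact: coord_le_norm.
Qed.

Definition bump_partial (s : R) i a x : R := - 4 * pospart (s - sqnorm (x - a)) * (x - a) 0 i.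

Context (s : R).
Hypothesis s0 : 0 <= s.

Let P a x := pospart (s - sqnorm (x - a)).

Let P_ge0 a x : 0 <= P a x. Proof. exact: pospart_ge0. Qed.

Let P_le a x : P a x <= s.
Proof. by rewrite /P ge_max s0 andbT lerBlDr lerDl sqnorm_ge0. Qed.

Let P_lipschitz a x y (D : R) : `|x - a| <= D -> `|y - x| <= 1 ->
  `|P a y - P a x| <= (\sum_(i < n) (2 * D + 1)) * `|y - x|.
Proof.
move=> xaD yx1; apply: le_trans (pospart_lipschitz _ _) _.
by rewrite opprB addrC addrA subrK distrC; exact: sqnormB_lipschitz.
Qed.

Lemma bump_le a x : `|bump s a x| <= s ^+ 2.
Proof. by rewrite ger0_norm ?bump_ge0// lerXn2r ?nnegrE ?P_ge0 ?P_le. Qed.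

Lemma bump_lipschitz a x y (D : R) : `|x - a| <= D -> `|y - x| <= 1 ->
  `|bump s a y - bump s a x| <= (2 * s * (\sum_(i < n) (2 * D + 1))) * `|y - x|.
Proof.
move=> xaD yx1; rewrite /bump -/(P a y) -/(P a x) subr_sqr normrM mulrC -mulrA.
apply: ler_pM => //; last exact: P_lipschitz.
by rewrite ger0_norm ?addr_ge0//; have := P_le a x; have := P_le a y; lra.
Qed.

Lemma bump_partial_le i a x (D : R) : `|x - a| <= D -> `|bump_partial s i a x| <= 4 * s * D.
Proof.
move=> xaD; rewrite /bump_partial normrM; apply: ler_pM => //.
  rewrite -/(P a x) normrM normrN (ger0_norm (P_ge0 _ _)) (ger0_norm (ler0n R 4)).
  by rewrite ler_wpM2l.
by apply: le_trans xaD; exact: coord_le_norm.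
Qed.

Lemma bump_partial_lipschitz i a x y (D : R) : `|x - a| <= D -> `|y - x| <= 1 ->
  `|bump_partial s i a y - bump_partial s i a x| <=
  (4 * (s + (\sum_(i < n) (2 * D + 1)) * D)) * `|y - x|.
Proof.
move=> xaD yx1; rewrite /bump_partial -/(P a y) -/(P a x).
have -> : - 4 * P a y * (y - a) 0 i - - 4 * P a x * (x - a) 0 i =
    - 4 * (P a y * (y - x) 0 i + (P a y - P a x) * (x - a) 0 i) by rewrite !mxE; ring.
rewrite normrM normrN (ger0_norm (ler0n R 4)) -mulrA ler_wpM2l//.
apply: le_trans (ler_normD _ _) _; rewrite [leRHS]mulrDl; apply: lerD.
  by rewrite normrM ger0_norm//; apply: ler_pM => //; exact: coord_le_norm.
rewrite normrM mulrAC; apply: ler_pM => //; first exact: P_lipschitz.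
by apply: le_trans xaD; exact: coord_le_norm.
Qed.

Lemma bump_derive_bound i a x (D h : R) : `|x - a| <= D -> `|h| <= 1 ->
  `|bump s a (h *: delta_mx 0 i + x) - bump s a x - h * bump_partial s i a x| <=
  ((2 * D + 1) ^+ 2 + 2 * s) * h ^+ 2.
Proof.
move=> xaD h1.
have -> : bump s a (h *: delta_mx 0 i + x) =
    pospart (s - (sqnorm (x - a) + 2 * h * (x - a) 0 i + h ^+ 2)) ^+ 2.
  rewrite /bump -addrA [_ + (x - a)]addrC (sqnormD (x - a)) dotpZr sqnormZ.
  have -> : sqnorm (delta_mx 0 i : 'rV[R]_n) = 1.
    rewrite /sqnorm (bigD1 i)//= mxE !eqxx expr1n big1 ?addr0// => j ji.
    by rewrite mxE eqxx (negbTE ji) expr0n.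
  have -> : dotp (x - a) (delta_mx 0 i) = (x - a) 0 i.
    rewrite /dotp (bigD1 i)//= [X in _ * X]mxE !eqxx mulr1 big1 ?addr0// => j ji.
    by rewrite [X in _ * X]mxE eqxx (negbTE ji) mulr0.
  by rewrite mulr1 mulrA.
rewrite /bump /bump_partial -/(P a x).
set c := (x - a) 0 i; set t := s - sqnorm (x - a).
rewrite (_ : s - _ = t - (2 * h * c + h ^+ 2)); last by rewrite /t; ring.
have := pospart_sqr_derive (t - (2 * h * c + h ^+ 2)) t; rewrite -/(P a x) -/t.
set A := pospart _ ^+ 2; set p := P a x => Ab.
have cD : `|c| <= D by apply: le_trans xaD; exact: coord_le_norm.
have -> : A - p ^+ 2 - h * (- 4 * p * c) =
  (A - p ^+ 2 - 2 * p * (t - (2 * h * c + h ^+ 2) - t)) - 2 * p * h ^+ 2 by ring.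
apply: le_trans (ler_normB _ _) _; rewrite [leRHS]mulrDl; apply: lerD; last first.
  have p0 : 0 <= p by exact: P_ge0.
  rewrite ger0_norm; last by rewrite mulr_ge0 ?sqr_ge0// mulr_ge0.
  by rewrite ler_wpM2r ?sqr_ge0// ler_wpM2l//; exact: P_le.
apply: le_trans Ab _.
rewrite (_ : _ ^+ 2 = (2 * c + h) ^+ 2 * h ^+ 2); last by ring.
rewrite ler_wpM2r ?sqr_ge0// -[leLHS]real_normK ?num_real// lerXn2r ?nnegrE//.
  by have := normr_ge0 c; lra.
apply: le_trans (ler_normD _ _) _; rewrite normrM ger0_norm//.
lra.
Qed.

End BumpRegularity.

(** * Superposition *)
Section AverageSum.
Context (R : realType) (n : nat) (J : 'rV[R]_n -> R).
Hypotheses (J_continuous : continuous J) (J_ge0 : forall x, 0 <= J x)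
  (J_supp : compactly_supported J) (J_mass : integral_Rn setT J = 1).

Lemma average_sum (w : nat -> R) (f : nat -> 'rV[R]_n -> R) N :
  (forall k, continuous (f k)) ->
  average J (fun z => \sum_(0 <= k < N) w k * f k z) =
  \sum_(0 <= k < N) w k * average J (f k).
Proof.
move=> cf; elim: N => [|N IH].
  rewrite big_geq//; under eq_fun do rewrite big_geq//.
  exact: (average_cst J_continuous J_ge0 J_supp J_mass).
have cw k : continuous (fun z => w k * f k z).
  by move=> z; exact: (continuousM (@cst_continuous _ _ (w k) z) (cf k z)).
have cS : continuous (fun z => \sum_(0 <= k < N) w k * f k z).
  by apply: continuous_big => [|k _]; [exact: add_continuous|exact: cw].
rewrite big_nat_recr//=; under eq_fun do rewrite big_nat_recr//=.
rewrite (averageD J_continuous J_ge0 J_supp J_mass cS (cw N)) IH.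
by rewrite (averageZ J_continuous J_ge0 J_supp J_mass (w N) (cf N)).
Qed.

Lemma integral_rescale (Om : set 'rV[R]_n) (r : R) (f : 'rV[R]_n -> R) x :
  0 < r -> continuous f -> (forall y, 0 <= f y) -> (forall y, ~ Om y -> f y = 0) ->
  integral_Rn Om (fun y => rescale J r (x - y) * f y) =
  average J (fun z => f (x - r^-1 *: z)).
Proof.
move=> r0 cf f0 fOm.
pose h y := rescale J r (x - y) * f y.
have -> : integral_Rn Om h = integral_Rn setT h.
  rewrite /integral_Rn preimage_setT Rintegral_mkcond; congr (Rintegral _ _ _).
  apply/funext => t; rewrite patchE; case: ifPn => // /negP Omt.
  by rewrite /h fOm ?mulr0// => Omr; apply: Omt; rewrite inE.
have cx (e : R) : continuous (fun z : 'rV[R]_n => x - e *: z) by exact: affine_continuous.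
have cJ : continuous (fun y : 'rV[R]_n => J (r *: (x - y))).
  rewrite (_ : (fun y => _) = J \o (fun y => r *: x - r *: y)); last first.
    by apply/funext => y /=; rewrite scalerBr.
  by move=> y; apply: continuous_comp; [exact: affine_continuous|exact: J_continuous].
have ch : continuous h.
  move=> y; exact: (continuousM (continuousM (@cst_continuous _ _ (r ^+ n) y) (cJ y)) (cf y)).
rewrite -(@integral_Rn_reflect_scale _ _ x r^-1 h) ?invr_gt0//; last 2 first.
- exact: measurable_continuous_row.
- by move=> y; rewrite mulr_ge0// mulr_ge0// exprn_ge0// ltW.
have cg : continuous (fun z : 'rV[R]_n => f (x - r^-1 *: z)).
  by move=> z; exact: (continuous_comp (cx r^-1 z) (cf _)).
have -> : integral_Rn setT (fun z : 'rV[R]_n => h (x - r^-1 *: z)) =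
    average J (fun z => r ^+ n * f (x - r^-1 *: z)).
  congr integral_Rn; apply/funext => z; rewrite /h /rescale.
  have -> : r *: (x - (x - r^-1 *: z)) = z.
    by rewrite opprB addrC subrK scalerA divff ?scale1r// gt_eqF.
  by rewrite mulrA [r ^+ n * _]mulrC.
rewrite (averageZ J_continuous J_ge0 J_supp J_mass _ cg) mulrA -exprMn mulVf ?gt_eqF//.
by rewrite expr1n mul1r.
Qed.

End AverageSum.

(** Halving the radius makes room to move the centre: rational points near the midpoint
   of [x] and the centre [a] of an inner ball of [x] are suitable. *)
Lemma dense_inner_balls (R : realType) n (Om : set 'rV[R]_n) (s : R) :
  0 < s -> (forall x, Om x -> in_inner_ball Om s x) ->
  forall x, Om x -> exists2 p : 'rV[rat]_n,
    eball (map_mx ratr p) (s / 4) x & eball (map_mx ratr p) (s / 4) `<=` Om.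
Proof.
move=> s0 inner x Omx; have [a xa aOm] := inner x Omx.
pose m := 2^-1 *: (x + a).
have sqnearm (y : 'rV[R]_n) : continuous (fun c : 'rV[R]_n => sqnorm (y - c)).
  move=> c; apply: continuous_comp; last exact: sqnorm_continuous.
  exact: (continuousB (@cst_continuous _ _ y c) (fun A => id)).
have n1 : \forall c \near m, sqnorm (x - c) < s / 4.
  have /cvgr_lt : sqnorm (x - c) @[c --> m] --> sqnorm (x - m) by exact: sqnearm.
  apply.
  have -> : x - m = 2^-1 *: (x - a) by apply/rowP => i; rewrite !mxE; field.
  rewrite sqnormZ; move: xa; rewrite /eball/=; lra.
have n2 : \forall c \near m, sqnorm (a - c) < s / 4.
  have /cvgr_lt : sqnorm (a - c) @[c --> m] --> sqnorm (a - m) by exact: sqnearm.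
  apply.
  have -> : a - m = 2^-1 *: - (x - a) by apply/rowP => i; rewrite !mxE; field.
  rewrite sqnormZ sqnormN; move: xa; rewrite /eball/=; lra.
have : \forall c \near m, sqnorm (x - c) < s / 4 /\ sqnorm (a - c) < s / 4.
  by near=> c; split; near: c.
move=> /nbhs_ballP[e /= e0 ebP].
have [p mp] := rat_row_dense m e0.
have [xp ap] := ebP _ (ball_sym mp).
exists p => // y; rewrite /eball/= => yp; apply: aOm; rewrite /eball/=.
have -> : y - a = (y - map_mx ratr p) - (a - map_mx ratr p) by rewrite opprB addrA subrK.
have := sqnorm_ge0 ((y - map_mx ratr p) + (a - map_mx ratr p)).
rewrite (sqnormD (y - _)) (sqnormB (y - _)); lra.
Unshelve. all: by end_near. Qed.

Lemma countable_inner_balls (R : realType) n (Om : set 'rV[R]_n) :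
  Om !=set0 -> open Om -> bounded_set Om -> smooth_boundary Om ->
  exists2 s : R, 0 < s & exists c : nat -> 'rV[R]_n,
    (forall k, eball (c k) s `<=` Om) /\ (forall x, Om x -> exists k, eball (c k) s x).
Proof.
move=> [x0 Omx0] oOm bOm smooth.
have [s s0 inner] := interior_ball_condition oOm bOm smooth.
have dense := dense_inner_balls s0 inner.
have [p0 _ p0Om] := dense _ Omx0.
exists (s / 4); first by rewrite divr_gt0.
pose good (p : 'rV[rat]_n) := `[< eball (map_mx ratr p : 'rV[R]_n) (s / 4) `<=` Om >].
pose c k : 'rV[R]_n :=
  if unpickle k is Some p then map_mx ratr (if good p then p else p0)
  else map_mx ratr p0.
exists c; split=> [k|x Omx].
  rewrite /c; case: unpickle => [p|//].
  by case: ifPn => // /asboolP.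
have [p xp pOm] := dense _ Omx.
by exists (pickle p); rewrite /c pickleK ifT//; exact/asboolP.
Qed.

Theorem lemma5p3 (R : realType) (n : nat) (n_gt0 : (0 < n)%N)
    (Omega0 : set 'rV[R]_n) (rho : R -> R) (k : R) (J : 'rV[R]_n -> R)
    (Omega0_domain : domain Omega0)
    (Omega0_bounded : bounded_set Omega0)
    (Omega0_convex : convex_set Omega0)
    (Omega0_smooth : smooth_boundary Omega0)
    (rho_gt0 : forall t, 0 <= t -> 0 < rho t)
    (rho_smooth : smooth_on_half_line rho)
    (rho0 : rho 0 = 1)
    (rho_pinfty : rho t @[t --> +oo] --> +oo)
    (k_ge0 : 0 <= k)
    (rho_log_deriv : rho^`()%classic t / rho t @[t --> +oo] --> k)
    (J_continuous : continuous J)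
    (J_ge0 : forall x, 0 <= J x)
    (J_supp : compactly_supported J)
    (J0_gt0 : 0 < J 0)
    (J_mass : integral_Rn setT J = 1)
    (J_center : forall i : 'I_n, integral_Rn setT (fun x => J x * x 0 i) = 0) :
  exists (phi : 'rV[R]_n -> R) (T : R),
    [/\ Ck_on 1 setT phi,
        forall x, 0 <= phi x,
        forall x, Omega0 x -> 0 < phi x &
        forall x, ~ Omega0 x -> phi x = 0] /\
    0 < T /\
    forall x t, T <= t ->
      integral_Rn Omega0 (fun y => rescale J (rho t) (x - y) * phi y) - phi x
        >= - (1 / rho t) * phi x.
Proof.
have [Om_n0 Om_open _] := Omega0_domain.
have [s s0 [c [cOm Omc]]] :=
  countable_inner_balls Om_n0 Om_open Omega0_bounded Omega0_smooth.
have s0' := ltW s0.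
pose F j x := bump s (c j) x.
pose phi x := dmean (F ^~ x).
have Fs j x : `|F j x| <= s ^+ 2 by exact: bump_le.
have Fc j : continuous (F j) by exact: bump_continuous.
have bF x : exists C : R, forall j, `|F j x| <= C by exists (s ^+ 2).
have [M cM] : exists M : R, forall j, `|c j| <= M.
  have [M [_ OmM]] := Omega0_bounded.
  exists (M + 1) => j; apply: (OmM (M + 1)); first by rewrite ltrDl.
  by apply: (cOm j); rewrite /eball/= subrr -(scale0r 0) sqnormZ expr0n mul0r.
have xcD x j : `|x - c j| <= `|x| + M.
  by apply: le_trans (ler_normB _ _) _; rewrite lerD2l.
have phi_continuous : continuous phi.
  apply: dmean_continuous => // x; eexists => j y yx1.
  exact: (bump_lipschitz s0' (xcD x j) yx1).
pose dphi i x := dmean (fun k => bump_partial s i (c k) x).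
have phi_derive x i : is_derive x (delta_mx 0 i) phi (dphi i x).
  apply: (@dmean_derive _ _ _ (fun k => bump_partial s i (c k))) => //.
    by eexists => j; exact: (bump_partial_le s0' i (xcD x j)).
  by eexists => j h h1; exact: (bump_derive_bound s0' i (xcD x j) h1).
have dphiE i : dpartial i phi = dphi i.
  by apply/funext => x; have [_ <-] := phi_derive x i.
have dphi_continuous i : continuous (dphi i).
  apply: (@dmean_continuous _ _ (fun k => bump_partial s i (c k))) => x.
    by eexists => j; exact: (bump_partial_le s0' i (xcD x j)).
  by eexists => j y yx1; exact: (bump_partial_lipschitz s0' i (xcD x j) yx1).
have phi_ge0 x : 0 <= phi x.
  have := dmean_ge_partial 0 (Fs^~ x) (fun k => bump_ge0 s (c k) x).
  by rewrite big_geq.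
have phi_out x : ~ Omega0 x -> phi x = 0.
  move=> Omx; rewrite /phi; under eq_fun do rewrite /F.
  rewrite (_ : (fun k => bump s (c k) x) = fun k => 0 * 0); last first.
    by apply/funext => j; rewrite mul0r bump_eq0// => /cOm.
  by rewrite (@dmeanZ _ 0 (fun=> 0) 0) ?mul0r// => j; rewrite normr0.
have [e0 e0_gt0 avg] :=
  average_bump_ge J_continuous J_ge0 J_supp J0_gt0 J_mass J_center s0.
have [T [T0 rhoT]] : exists T : R, 0 < T /\ forall t, T <= t -> e0^-1 <= rho t.
  have /cvgryPge/(_ e0^-1) := rho_pinfty.
  move=> [A [_ hA]]; exists (Num.max (A + 1) 1); split; first by rewrite lt_max ltr01 orbT.
  by move=> t; rewrite ge_max => /andP[At _]; apply: hA; lra.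
exists phi, T; split; [split=> //|split=> // x t Tt].
- move=> [|i [|//]] _ x _ /=; split.
  + exact: phi_continuous.
  + by move=> _ i; have [] := phi_derive x i.
  + by rewrite dphiE; exact: dphi_continuous.
  + by [].
- move=> x /Omc[j xj].
  have := dmean_ge_partial j.+1 (Fs^~ x) (fun k => bump_ge0 s (c k) x).
  apply: lt_le_trans; rewrite big_nat_recr//= ltr_wpDl//.
    by apply: sumr_ge0 => i _; rewrite mulr_ge0 ?bump_ge0// ltW// dyadic_gt0.
  by rewrite mulr_gt0 ?dyadic_gt0// bump_gt0.
have rt0 : 0 < rho t by apply: rho_gt0; apply: le_trans Tt; exact: ltW.
have et : 0 < (rho t)^-1 <= e0.
  by rewrite invr_gt0 rt0 -[leRHS]invrK lef_pV2 ?posrE ?invr_gt0// rhoT.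
rewrite integral_rescale// lerBrDr.
rewrite (_ : _ + _ = (1 - (rho t)^-1) * phi x); last by rewrite div1r mulrBl mul1r mulNr addrC.
set e := (rho t)^-1 in et *.
have cx : continuous (fun z : 'rV[R]_n => x - e *: z) by exact: affine_continuous.
(* phi dominates its partial sums, to which the inequality for bumps applies. *)
have partial N : (1 - e) * (\sum_(0 <= j < N) dyadic R j * F j x) <=
    average J (fun z => phi (x - e *: z)).
  have cFj j : continuous (fun z : 'rV[R]_n => F j (x - e *: z)).
    by move=> z; exact: (continuous_comp (cx z) (Fc j _)).
  apply: (@le_trans _ _ (average J (fun z => \sum_(0 <= j < N) dyadic R j * F j (x - e *: z)))).
    rewrite average_sum// mulr_sumr; apply: ler_sum => j _.
    rewrite mulrCA ler_wpM2l ?(ltW (dyadic_gt0 _ _))//; exact: avg.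
  apply: le_average => //.
  - apply: continuous_big => [|j _ z]; first exact: add_continuous.
    exact: (continuousM (@cst_continuous _ _ (dyadic R j) z) (cFj j z)).
  - by move=> z; exact: (continuous_comp (cx z) (phi_continuous _)).
  by move=> z _; apply: dmean_ge_partial => // j; exact: bump_ge0.
have cphi : series (fun j => dyadic R j * F j x) @ \oo --> phi x by exact: (is_cvg_dmean (Fs^~ x)).
have cphi' : (fun N => (1 - e) * series (fun j => dyadic R j * F j x) N) @ \oo --> (1 - e) * phi x.
  by apply: cvgM => //; exact: cvg_cst.
rewrite -(cvg_lim (@Rhausdorff R) cphi'); apply: limr_le.
  by apply/cvg_ex; eexists; exact: cphi'.
by near=> N; exact: partial.
Unshelve. all: by end_near. Qed.
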